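(* Let $n\ge1$ and let $\mathfrak{c},\mathfrak{C}>0$. There exist positive constants $\mathscr{C}_1,\mathscr{C}_2$, depending only on $n,\mathfrak{c},\mathfrak{C}$ (in particular not on $N$), such that the following holds for every $N\ge 1$. Let $\mathcal{S}=(\mathcal{S}^{j,k})_{j,k=1}^n$ be a real symmetric $nN\times nN$ matrix with non-negative entries, where each $\mathcal{S}^{j,k}$ is an $N\times N$ matrix, such that: (1) for each $j,k$, either all entries of $\mathcal{S}^{j,k}$ are positive or all entries of $\mathcal{S}^{j,k}$ are zero; (2) if all entries of $\mathcal{S}^{j,k}$ are positive, then $\frac{\mathfrak{c}}{N}<\mathcal{S}^{j,k}_{\nu,\tau}<\frac{\mathfrak{C}}{N}$ for all $\nu,\tau\in\{1,\ldots,N\}$; (3) $\mathcal{S}^{j,k}=0$ if $j+k>n+1$; (4) all entries of $\mathcal{S}^{j,k}$ are positive if $j+k\in\{n,n+1\}$. Let $m=(m_1,\ldots,m_{nN}):\mathbb{H}\to\mathbb{H}^{nN}$ be the solution of $-\frac1{m(z)}=z+\mathcal{S}m(z)$. Then there is a neighbourhood $U$ of zero in $\mathbb{H}$ such that for all $k\in\{1,\ldots,nN\}$ and $z\in U$ $$\mathscr{C}_1<|m_k(z)|\cdot|z|^{-\left(1-\frac{2}{n+1}\left\lceil\frac{k}{N}\right\rceil\right)}<\mathscr{C}_2 .$$ Moreover, for all $k\in\{1,\ldots,nN\}$, $$\arg\left(m_k(z)\,z^{-\left(1-\frac{2}{n+1}\left\lceil\frac{k}{N}\right\rceil\right)}\right)\to\frac{\pi}{n+1}\left\lceil\frac{k}{N}\right\rceil\quad\text{as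 } z\to0,\ z\in\mathbb{H},$$ where the branch of $z^{-\left(1-\frac{2}{n+1}\left\lceil\frac{k}{N}\right\rceil\right)}$ in $\mathbb{H}$ is chosen so that it is positive for positive $z$.
   Context: $\mathbb{H}$ is the open complex upper half-plane; a neighbourhood of zero in $\mathbb{H}$ is the intersection of $\mathbb{H}$ with a neighbourhood of $0$ in $\mathbb{C}$. The equation $-1/m=z+\mathcal{S}m$ is understood entrywise: $-1/m_k(z)=z+\sum_{j=1}^{nN}\mathcal{S}_{k,j}m_j(z)$ for all $k\in\{1,\ldots,nN\}$ and $z\in\mathbb{H}$; it is known that for every $z\in\mathbb{H}$ it has a unique solution $m(z)\in\mathbb{H}^{nN}$. The branch is $z^\alpha=|z|^\alpha e^{i\alpha\arg z}$ with $\arg z\in(0,\pi)$ for $z\in\mathbb{H}$; the convergence of arguments is for the principal argument in $(-\pi,\pi]$. *)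

(* Defs.v *)
From HB Require Import structures.
From mathcomp Require Import all_boot all_order all_algebra.
From mathcomp Require Import all_classical all_reals all_analysis.
From mathcomp Require Import complex.

Set Implicit Arguments.
Unset Strict Implicit.
Unset Printing Implicit Defensive.

Import Order.TTheory GRing.Theory Num.Theory.
Import numFieldNormedType.Exports.
Import ComplexField.Normc.

Local Open Scope classical_set_scope.
Local Open Scope ring_scope.
Local Open Scope complex_scope.

Definition uhp (R : realType) : set R[i] := [set z | 0 < complex.Im z].

(* [R[i]^o] is the alias of [R[i]] carrying the topology of the modulus. *)
Definition nbhs0 (R : realType) : set_system R[i] := nbhs (0 : R[i]^o).

Definition is_uhp_nbhd0 (R : realType) (U : set R[i]) : Prop :=
  exists2 V : set R[i], nbhs0 V & U = V `&` @uhp R.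

(* Principal argument, with values in ]-pi, pi] for z != 0 (the value at 0 is
   irrelevant). *)
Definition carg (R : realType) (z : R[i]) : R :=
  let theta := acos (complex.Re z / normc z) in
  if 0 <= complex.Im z then theta else - theta.

(* |z|^a e^{i a arg z}, used on the upper half-plane, where carg z is
   in ]0, pi[. *)
Definition cpow (R : realType) (z : R[i]) (a : R) : R[i] :=
  (normc z `^ a)%:C * (cos (a * carg z) +i* sin (a * carg z)).

Lemma block_ord_subproof (n N : nat) (j : 'I_n) (nu : 'I_N) :
  (j * N + nu < n * N)%N.
Proof.
apply: (@leq_trans (j.+1 * N)); first by rewrite mulSn addnC ltn_add2r.
by rewrite leq_mul2r ltn_ord orbT.
Qed.

Definition block_ord (n N : nat) (j : 'I_n) (nu : 'I_N) : 'I_(n * N) :=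
  Ordinal (block_ord_subproof j nu).

(* The N x N block S^{j+1,k+1}: ordinals are 0-based. *)
Definition block (R : realType) (n N : nat) (S : 'M[R]_(n * N)) (j k : 'I_n) :
    'M[R]_N :=
  mxsub (@block_ord n N j) (@block_ord n N k) S.

Definition posmx (R : realType) (N : nat) (A : 'M[R]_N) : Prop :=
  forall nu tau : 'I_N, 0 < A nu tau.

(* -1/m = z + S m entrywise on the upper half-plane, with m valued there. *)
Definition is_solution (R : realType) (d : nat) (S : 'M[R]_d)
    (m : R[i] -> 'I_d -> R[i]) : Prop :=
  forall z : R[i], uhp z ->
    (forall k : 'I_d, uhp (m z k)) /\
    (forall k : 'I_d,
      - (1 / m z k) = z + \sum_(j < d) (S k j)%:C * m z j).

(* The ceiling of k/N for the 1-based index k = i+1. *)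
Definition ceilidx (R : realType) (n N : nat) (i : 'I_(n * N)) : R :=
  (Num.ceil (i.+1%:R / N%:R : R))%:~R.

Definition expo (R : realType) (n N : nat) (i : 'I_(n * N)) : R :=
  1 - 2 / n.+1%:R * ceilidx R i.

(* Main.v *)
Require Import Defs.
From HB Require Import structures.
From mathcomp Require Import all_boot all_order all_algebra.
From mathcomp Require Import all_classical all_reals all_analysis.
From mathcomp Require Import complex.
From mathcomp Require Import zify ring lra.

(** Let theta = arg z and let delta = |z|^(2/(n+1)) e^(-i(pi - 2 theta)/(n+1)),
so that delta^(n+1) = -z^2 and |arg delta| < pi/(n+1).  Writing
m_k = z delta^(-j) x_k for k in the j-th block turns the equation into
      x_k * sum_l S_kl delta^(n+1-b_k-b_l) x_l = 1,
where b is the number of the block and where one extra index, of level 0 and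
with x = 1, accounts for the term z.  As S vanishes when b_k + b_l > n+1, only
nonnegative powers of delta occur: the singular problem at z = 0 has become a
regular one at delta = 0.  The factor z delta^(-j) has modulus
|z|^(1-2j/(n+1)) and argument (1-2j/(n+1)) theta + j pi/(n+1), so the theorem
says that the x_k converge to positive numbers bounded above and below in terms
of n and the two constants.  The argument of delta stays in a fixed sector, so
everything is uniform in the direction in which z tends to 0.

The limit.  At delta = 0 only the pairs with b_k + b_l = n+1 interact; the
positive solutions of x_k sum_l S_kl x_l = 1 exist by minimising a convex
function ([sinkhorn]) but are not isolated, because level j may be multiplied
by t and level n+1-j by 1/t.  The terms of order delta, which come from the
pairs with b_k + b_l = n, are solvable against this degeneracy only if the
quantities sum_(b_k = j) x_k sum_(b_l = n-j) S_kl x_l agree for all j from 0 to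
n, and this condition can be met by rescaling the levels
([balanced_profile]).  Together the two families of relations say that the
block means of x form a geometric progression up to factors controlled by the
entry bounds, and that this progression returns to its start; hence all of
them are controlled ([geometric_bounds], [profile_bounds]).

Existence for small delta.  The linearisation at the leading profile is only
of order delta in the degenerate directions.  The identity [cayley_energy],
written in terms of c = (x - x')/(x + x'), expresses the pairing of the
difference of two residuals with c as a weighted sum of |c_k + c_l|^2.  The
weights with b_k + b_l = n+1 are of order 1, those with b_k + b_l = n have real
part of order |delta|, and walking through the levels 0, n, 1, n-1, 2, ... shows
that together they control |delta| times the squared norm of c
([dirichlet_coercive], [energy_coercive]); for n = 1 those of the first kind
suffice.  A first-order correction of the profile
leaves a residual of order delta^2 ([first_order_correction],
[approximate_solution]), which is small compared with the gap.  Therefore the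
minimiser of the residual over a fixed box is interior ([residual_stable]), and
it must be a zero since otherwise the residual could be decreased
([defect_descent]); this is [local_solution].

Conclusion.  The solution so obtained lies in the upper half-plane
([size_at_uhp]), where the equation has only one solution
([solves_at_unique]); it is therefore the given m(z). *)

Import Order.TTheory GRing.Theory Num.Theory.
Import numFieldNormedType.Exports.
Import ComplexField.Normc.

Local Open Scope classical_set_scope.
Local Open Scope ring_scope.
Local Open Scope complex_scope.

Set Implicit Arguments.
Unset Strict Implicit.
Unset Printing Implicit Defensive.

(** * Minimisation over boxes and complex moduli *)

Lemma box_min (R : realType) (p : nat) (f : 'rV[R]_p -> R) (L : R) :
  0 <= L -> continuous f ->
  exists2 v : 'rV[R]_p, (forall i, `|v 0 i| <= L) &
    forall u : 'rV[R]_p, (forall i, `|u 0 i| <= L) -> f v <= f u.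
Proof.
move=> L0 fc.
pose A : set 'rV[R]_p := [set v | forall i, v 0 i \in `[- L, L]].
have inA v : A v <-> forall i, `|v 0 i| <= L.
  by split=> h i; have := h i; rewrite in_itv /= ler_norml.
have cA : compact A.
  rewrite (_ : A = [set v : 'rV[R]_p | forall i, `[- L, L]%classic (v ord0 i)]);
    last by apply/seteqP; split => v h i; have := h i.
  apply: (@rV_compact _ _ (fun=> `[- L, L]%classic)) => _.
  exact: segment_compact.
have A0 : A !=set0 by exists 0; apply/inA => i; rewrite mxE normr0.
have [v Av vmin] := EVT_min_rV A0 cA (continuous_subspaceT fc).
exists v; first by move: Av; rewrite inE => /inA.
by move=> u /inA uA; apply: vmin; rewrite inE.
Qed.

Section ComplexModulus.
Variable R : realType.
Implicit Types z w : R[i].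

Definition nsq z : R := complex.Re z ^+ 2 + complex.Im z ^+ 2.

Lemma nsq_ge0 z : 0 <= nsq z.
Proof. by rewrite addr_ge0 ?sqr_ge0. Qed.

Lemma nsqE z : nsq z = normc z ^+ 2.
Proof. by case: z => a b; rewrite /nsq /= sqr_sqrtr // addr_ge0 ?sqr_ge0. Qed.

Lemma normc_ge0 z : 0 <= normc z.
Proof. by case: z => a b /=; exact: sqrtr_ge0. Qed.

Lemma normc_eq0 z : (normc z == 0) = (z == 0).
Proof.
by apply/eqP/eqP => [|->]; [exact: eq0_normc|exact: normc0].
Qed.

Lemma normc_gt0 z : (0 < normc z) = (z != 0).
Proof. by rewrite lt_neqAle normc_ge0 andbT eq_sym normc_eq0. Qed.

Lemma normcX z k : normc (z ^+ k) = normc z ^+ k.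
Proof.
by elim: k => [|k IH]; rewrite ?expr0 ?normc1 // !exprS normcM IH.
Qed.

Lemma normcC (a : R) : normc a%:C = `|a|.
Proof. by rewrite /= expr0n /= addr0 sqrtr_sqr. Qed.

Lemma normc_Re z : `|complex.Re z| <= normc z.
Proof.
by case: z => a b /=; rewrite -sqrtr_sqr ler_wsqrtr // lerDl sqr_ge0.
Qed.

Lemma normc_Im z : `|complex.Im z| <= normc z.
Proof.
by case: z => a b /=; rewrite -sqrtr_sqr ler_wsqrtr // lerDr sqr_ge0.
Qed.

Lemma normc_ReIm z : normc z <= `|complex.Re z| + `|complex.Im z|.
Proof.
case: z => a b /=.
rewrite -[leRHS]ger0_norm ?addr_ge0 // -sqrtr_sqr ler_wsqrtr //.
rewrite -[a ^+ 2]real_normK ?num_real // -[b ^+ 2]real_normK ?num_real //.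
have := normr_ge0 a; have := normr_ge0 b; nra.
Qed.

Lemma normc_sum (I : Type) (s : seq I) (P : pred I) (F : I -> R[i]) :
  normc (\sum_(k <- s | P k) F k) <= \sum_(k <- s | P k) normc (F k).
Proof.
elim/big_ind2 : _ => [|x a y b xa yb|//]; first by rewrite normc0.
exact: le_trans (le_normcD _ _) (lerD xa yb).
Qed.

Lemma Re_mulC (a : R) z : complex.Re (a%:C * z) = a * complex.Re z.
Proof. by case: z => x y /=; rewrite mul0r subr0. Qed.

Lemma Re_sum (I : Type) (s : seq I) (P : pred I) (F : I -> R[i]) :
  complex.Re (\sum_(k <- s | P k) F k) = \sum_(k <- s | P k) complex.Re (F k).
Proof. by apply: (big_morph (@complex.Re R)) => [[? ?] [? ?]|]. Qed.

Lemma Im_sum (I : Type) (s : seq I) (P : pred I) (F : I -> R[i]) :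
  complex.Im (\sum_(k <- s | P k) F k) = \sum_(k <- s | P k) complex.Im (F k).
Proof. by apply: (big_morph (@complex.Im R)) => [[? ?] [? ?]|]. Qed.

Lemma nsqD_le z w : nsq (z + w) <= 2 * nsq z + 2 * nsq w.
Proof.
case: z w => [a b] [c d]; rewrite /nsq /=.
have := sqr_ge0 (a - c); have := sqr_ge0 (b - d); nra.
Qed.

Lemma Re_conjM z w :
  complex.Re (z^* * w) = complex.Re z * complex.Re w + complex.Im z * complex.Im w.
Proof. by case: z w => [a b] [c d] /=; rewrite mulNr opprK. Qed.

End ComplexModulus.

(** * Staircase interactions and their coercivity *)

(** The index ord0 is the extra index that stands for the term z of the
    equation; it is the only one of level 0. Levels 1 to n are the blocks. *)
Record staircase (R : realType) (n p : nat) (b : 'I_p.+1 -> nat)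
    (S : 'I_p.+1 -> 'I_p.+1 -> R) : Prop := Staircase {
  stair_n_gt0 : (0 < n)%N;
  stair_root : b ord0 = 0%N;
  stair_level : forall k, k != ord0 -> (0 < b k <= n)%N;
  stair_onto : forall j, (j <= n)%N -> exists k, b k = j;
  stair_sym : forall k l, S k l = S l k;
  stair_pos : forall k l,
    (b k + b l == n)%N || (b k + b l == n.+1)%N -> 0 < S k l;
  stair_zero : forall k l, (n.+1 < b k + b l)%N -> S k l = 0 }.

(** Products are linear in the Cayley coordinate: with x = mu (1 + c) and x' =
    mu (1 - c) one has x_k x_l - x'_k x'_l = 2 mu_k mu_l (c_k + c_l), without
    remainder. Symmetrising in k and l then leaves only |c_k + c_l|^2. This
    replaces the logarithm, for which the same statement holds to first order
    only. *)
Lemma cayley_energy (R : realType) (I : finType) (T : I -> I -> R[i])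
    (mu c : I -> R[i]) :
  (forall k l, T k l = T l k) ->
  complex.Re (\sum_k (c k)^* *
     (mu k * (1 + c k) * (\sum_l T k l * (mu l * (1 + c l)))
      - mu k * (1 - c k) * (\sum_l T k l * (mu l * (1 - c l)))))
  = \sum_k \sum_l complex.Re (T k l * mu k * mu l) * nsq (c k + c l).
Proof.
move=> Tsym.
pose A k l := T k l * mu k * mu l.
have Asym k l : A k l = A l k by rewrite /A (Tsym k l); ring.
transitivity (complex.Re (\sum_k \sum_l A k l * ((c k + c l)^* * (c k + c l)))).
  congr complex.Re.
  have -> : \sum_k \sum_l A k l * ((c k + c l)^* * (c k + c l)) =
      \sum_k \sum_l A k l * ((c k)^* * (c k + c l)) +
      \sum_k \sum_l A k l * ((c l)^* * (c k + c l)).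
    rewrite -big_split; apply: eq_bigr => k _ /=.
    rewrite -big_split; apply: eq_bigr => l _ /=.
    by rewrite rmorphD /=; ring.
  rewrite [X in _ = _ + X]exchange_big /=.
  have -> : \sum_k \sum_l A l k * ((c k)^* * (c l + c k)) =
     \sum_k \sum_l A k l * ((c k)^* * (c k + c l)).
    by apply: eq_bigr => k _; apply: eq_bigr => l _; rewrite Asym (addrC (c l)).
  rewrite -big_split; apply: eq_bigr => k _ /=.
  rewrite -big_split /= !mulr_sumr -sumrB mulr_sumr.
  by apply: eq_bigr => l _; rewrite /A; ring.
rewrite Re_sum; apply: eq_bigr => k _; rewrite Re_sum; apply: eq_bigr => l _.
rewrite -/(A k l); move: (A k l) (c k + c l) => [u v] [x y].
by rewrite /nsq /=; ring.
Qed.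

Section Coercivity.
Variables (R : realType) (n p : nat) (b : 'I_p.+1 -> nat).
Variable S : 'I_p.+1 -> 'I_p.+1 -> R.
Hypothesis st : staircase n b S.

(** The order of magnitude of the real part of the coefficient of |c_k + c_l|^2
    when the small parameter has modulus r. For n = 1 the anti-diagonal b_k +
    b_l = n carries no weight: there the small parameter may come close to the
    imaginary axis, and the main anti-diagonal suffices. *)
Definition weight (r : R) (k l : 'I_p.+1) : R :=
  if (b k + b l == n.+1)%N then 1
  else if (b k + b l == n)%N && (1 < n)%N then r else 0.

Definition gap (r : R) : R := if (1 < n)%N then r else 1.

Lemma weight_ge0 r k l : 0 <= r -> 0 <= weight r k l.
Proof. by rewrite /weight => r0; do 2?case: ifP. Qed.

Definition dirichlet (r : R) (c : 'I_p.+1 -> R[i]) : R :=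
  \sum_k \sum_l weight r k l * nsq (c k + c l).

Lemma dirichlet_term r c k l :
  0 <= r -> weight r k l * nsq (c k + c l) <= dirichlet r c.
Proof.
move=> r0; rewrite /dirichlet (bigD1 k) //= (bigD1 l) //= -addrA lerDl.
apply: addr_ge0; apply: sumr_ge0 => i _; rewrite ?mulr_ge0 ?weight_ge0 ?nsq_ge0 //.
by apply: sumr_ge0 => j _; rewrite mulr_ge0 ?weight_ge0 ?nsq_ge0.
Qed.

(** Starting from the vanishing value at ord0, control passes from level j to
    level n - j along the anti-diagonal n, and from there to level j + 1 along
    the anti-diagonal n + 1. Each step loses a constant factor only. *)
Lemma dirichlet_level (j : nat) : (j <= n)%N -> (1 < n)%N ->
  exists2 A : R, 0 <= A & forall r c k, 0 < r <= 1 -> c ord0 = 0 ->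
    b k = j -> r * nsq (c k) <= A * dirichlet r c.
Proof.
move=> + n1; elim: j => [|j IH] jn.
  exists 0 => // r c k _ c0 bk; have -> : k = ord0.
    apply/eqP/negPn/negP => /(stair_level st); rewrite bk //.
  by rewrite c0 /nsq /= expr0n /= addr0 mulr0 mul0r.
have [A A0 HA] := IH (ltnW jn).
exists (2 + 2 * (2 + 2 * A)); first by lra.
move=> r c k /andP[r0 r1] c0 bk.
have [i bi] := stair_onto st (ltnW jn).
(* the path from level j to level j + 1 passes through level n - j *)
have [l bl] := stair_onto st (leq_subr j n).
have r0' := ltW r0.
have h1 := HA r c i _ c0 bi; rewrite r0 r1 in h1; have {}h1 := h1 isT.
have h2 := dirichlet_term c l i r0'.
have h3 := dirichlet_term c k l r0'.
have e2 : (b l + b i == n)%N by rewrite bl bi subnK // ltnW.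
have e3 : (b k + b l == n.+1)%N by rewrite bk bl addSn addnC subnK // ltnW.
have ne : (n == n.+1) = false by apply/negbTE; rewrite neq_ltn ltnSn.
rewrite /weight (eqP e2) ne eqxx n1 /= in h2.
rewrite /weight e3 mul1r in h3.
have s2 : nsq (c l) <= 2 * nsq (c l + c i) + 2 * nsq (c i).
  by have := nsqD_le (c l + c i) (- c i);
    rewrite addrK -[nsq (- c i)]/(nsq _) !nsqE normcN.
have s3 : nsq (c k) <= 2 * nsq (c k + c l) + 2 * nsq (c l).
  by have := nsqD_le (c k + c l) (- c l); rewrite addrK !nsqE normcN.
have D0 := nsq_ge0 (c k + c l).
have := nsq_ge0 (c l); have := nsq_ge0 (c i).
move: (nsq _) (nsq _) (nsq _) (nsq _) (nsq _) (dirichlet r c) h1 h2 h3 s2 s3 D0.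
move=> a1 a2 a3 a4 a5 D; nra.
Qed.

(** For n = 1 every index other than ord0 is linked to itself, and |2 c_k|^2
    already controls c_k. *)
Lemma dirichlet_coercive : exists2 K : R, 0 < K & forall r c,
  0 < r <= 1 -> c ord0 = 0 ->
  K * gap r * (\sum_k nsq (c k)) <= dirichlet r c.
Proof.
suff [A A0 HA] : exists2 A : R, 0 < A & forall r c k, 0 < r <= 1 -> c ord0 = 0 ->
    gap r * nsq (c k) <= A * dirichlet r c.
  exists (A * p.+1%:R)^-1; first by rewrite invr_gt0 mulr_gt0 // ltr0n.
  move=> r c rI c0; rewrite -mulrA mulrC ler_pdivrMr ?mulr_gt0 ?ltr0n //.
  rewrite mulr_sumr; apply: le_trans (_ : \sum_(k < p.+1) A * dirichlet r c <= _).
    by apply: ler_sum => k _; exact: HA.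
  by rewrite sumr_const card_ord -[leLHS]mulr_natr mulrAC mulrC.
have [n1|n1] := ltnP 1 n; last first.
  have n1' : n = 1%N by have := stair_n_gt0 st; lia.
  exists 1 => // r c k /andP[r0 r1] c0; rewrite /gap ltnNge n1 /= !mul1r.
  have D0 : 0 <= dirichlet r c.
    apply: sumr_ge0 => i _; apply: sumr_ge0 => j _.
    by rewrite mulr_ge0 ?nsq_ge0 ?weight_ge0 // ltW.
  have [->|k0] := eqVneq k ord0; first by rewrite c0 /nsq /= expr0n addr0.
  have := dirichlet_term c k k (ltW r0).
  have bk : b k = 1%N by have := stair_level st k0; rewrite n1'; lia.
  rewrite /weight bk n1' /= mul1r; apply: le_trans.
  case: (c k) => x y; rewrite /nsq /=.
  by have := sqr_ge0 x; have := sqr_ge0 y; nra.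
have /choice[A HA] : forall j : 'I_n.+1, exists a : R, 0 <= a /\ forall r c k,
    0 < r <= 1 -> c ord0 = 0 -> b k = j -> r * nsq (c k) <= a * dirichlet r c.
  by move=> j; have [A A0 HA] := dirichlet_level (ltnSE (ltn_ord j)) n1; exists A.
exists (1 + \sum_j A j).
  by rewrite ltr_pwDl // sumr_ge0 // => j _; case: (HA j).
move=> r c k rI c0; rewrite /gap n1.
have bk : (b k < n.+1)%N.
  have [->|k0] := eqVneq k ord0; first by rewrite (stair_root st).
  by have /andP[_] := stair_level st k0.
have [A0 /(_ r c k rI c0 erefl)] := HA (Ordinal bk).
move/le_trans; apply; rewrite ler_wpM2r //.
  case/andP: rI => r0 _; apply: sumr_ge0 => i _; apply: sumr_ge0 => j _.
  by rewrite mulr_ge0 ?nsq_ge0 ?weight_ge0 // ltW.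
rewrite (bigD1 (Ordinal bk)) //= addrCA lerDl addr_ge0 // sumr_ge0 // => j _.
by case: (HA j).
Qed.

End Coercivity.

(** * Lower bound on the energy for a small complex parameter *)

Lemma fin_lower_bound (R : realType) (I : finType) (P : pred I) (f : I -> R) :
  (forall i, P i -> 0 < f i) ->
  exists2 s : R, 0 < s & forall i, P i -> s <= f i.
Proof.
move=> f0; exists (\big[Num.min/1]_(i | P i) f i).
  by apply: lt_bigmin => // i Pi; exact: f0.
by move=> i Pi; exact: bigmin_le_cond.
Qed.

Lemma fin_upper_bound (R : realType) (I : finType) (f : I -> R) :
  exists2 M : R, 0 < M & forall i, `|f i| <= M.
Proof.
exists (1 + \sum_i `|f i|); first by rewrite ltr_pwDl // sumr_ge0.
by move=> i; rewrite (bigD1 i) //= addrCA lerDl addr_ge0 // sumr_ge0.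
Qed.

Section Energy.
Variables (R : realType) (n p : nat) (b : 'I_p.+1 -> nat).
Variable S : 'I_p.+1 -> 'I_p.+1 -> R.
Hypothesis st : staircase n b S.

(** The entries of S in the regularised problem; the truncated subtraction is
    harmless because S vanishes when the level sum exceeds n+1. *)
Definition scaled (d : R[i]) (k l : 'I_p.+1) : R[i] :=
  (S k l)%:C * d ^+ (n.+1 - (b k + b l)).

Lemma scaled_sym d k l : scaled d k l = scaled d l k.
Proof. by rewrite /scaled (stair_sym st) addnC. Qed.

Variable x0 : 'I_p.+1 -> R.
Hypothesis x0_gt0 : forall k, 0 < x0 k.

Lemma product_close (rho : R) (mu : 'I_p.+1 -> R[i]) k l :
  rho <= 1 -> (forall k, normc (mu k - (x0 k)%:C) <= rho * x0 k) ->
  normc (mu k * mu l - (x0 k * x0 l)%:C) <= 3 * rho * (x0 k * x0 l).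
Proof.
move=> rho1 Hmu; have hk := Hmu k; have hl := Hmu l.
set e := mu k - _ in hk; set e' := mu l - _ in hl.
have -> : mu k * mu l - (x0 k * x0 l)%:C =
    (x0 k)%:C * e' + (x0 l)%:C * e + e * e'.
  by rewrite rmorphM /e /e' /=; ring.
apply: le_trans (le_normcD _ _) _.
apply: le_trans (lerD (le_normcD _ _) (lexx _)) _.
rewrite !normcM !normcC !gtr0_norm //.
have := normc_ge0 e; have := normc_ge0 e'; have := x0_gt0 k; have := x0_gt0 l.
move: (x0 k) (x0 l) (normc e) (normc e') hk hl => u v a a' hk hl v0 u0 a0' a0.
have rho0 : 0 <= rho by rewrite -(pmulr_lge0 _ u0); apply: le_trans hk.
have h1 : u * a' <= u * (rho * v) by rewrite ler_pM2l.
have h2 : v * a <= v * (rho * u) by rewrite ler_pM2l.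
have h3 : a * a' <= (rho * u) * (rho * v) by apply: ler_pM.
have h4 : (rho * u) * (rho * v) <= rho * (u * v).
  by rewrite mulrACA; apply: ler_wpM2r; [rewrite mulr_ge0 ?ltW|exact: ler_piMr].
lra.
Qed.

Lemma exponent_ge (q s : nat) : (s <= q.+1)%N -> s != q.+1 ->
  (1 <= q.+1 - s)%N /\ (s != q -> 2 <= q.+1 - s)%N.
Proof. by lia. Qed.

(** On the two distinguished anti-diagonals the product mu_k mu_l is close to
    the positive number x0_k x0_l, and the small parameter stays in a sector
    around the positive axis, so the real parts are positive of the expected
    size. Every other entry carries at least one more power of the small
    parameter. *)
Lemma energy_pointwise (k0 : R) : 0 < k0 <= 1 ->
  exists rho s M : R, [/\ 0 < rho <= 1, 0 < s, 0 < M &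
    forall d mu k l, 0 < normc d <= 1 ->
    ((1 < n)%N -> k0 * normc d <= complex.Re d) ->
    (forall k, normc (mu k - (x0 k)%:C) <= rho * x0 k) ->
    s * weight n b (normc d) k l - M * normc d * gap n (normc d)
      <= complex.Re (scaled d k l * mu k * mu l)].
Proof.
move=> /andP[k0_gt0 k0_le1].
have [s s0 Hs] := @fin_lower_bound R _
  (fun i : 'I_p.+1 * 'I_p.+1 =>
     (b i.1 + b i.2 == n)%N || (b i.1 + b i.2 == n.+1)%N)
  (fun i => S i.1 i.2 * (x0 i.1 * x0 i.2))
  (fun i Pi => mulr_gt0 (stair_pos st Pi) (mulr_gt0 (x0_gt0 _) (x0_gt0 _))).
have [M M0 HM] := @fin_upper_bound R _
  (fun i : 'I_p.+1 * 'I_p.+1 => S i.1 i.2 * (x0 i.1 * x0 i.2)).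
exists (k0 / 12), (s * (k0 / 2)), (4 * M); split => //.
- by apply/andP; split; lra.
- by rewrite !mulr_gt0 // invr_gt0.
- by rewrite mulr_gt0.
move=> d mu k l /andP[d0 d1] Hd Hmu.
have rho1 : k0 / 12 <= 1 by lra.
have hE := product_close k l rho1 Hmu.
set E := mu k * mu l - _ in hE.
have Emu : mu k * mu l = (x0 k * x0 l)%:C + E by rewrite /E; ring.
have G0 : 0 < gap n (normc d) by rewrite /gap; case: ifP.
have W0 : 0 <= 4 * M * normc d * gap n (normc d).
  by rewrite !mulr_ge0 // ?ltW.
have xx0 : 0 < x0 k * x0 l by rewrite mulr_gt0.
have -> : scaled d k l * mu k * mu l =
    (S k l)%:C * (d ^+ (n.+1 - (b k + b l)) * ((x0 k * x0 l)%:C + E)).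
  by rewrite -Emu /scaled !mulrA.
rewrite Re_mulC.
have [e1|e1] := eqVneq (b k + b l)%N n.+1.
  have ss := Hs (k, l); rewrite /= e1 eqxx orbT in ss; have {}ss := ss isT.
  have S0 : 0 < S k l by apply: (stair_pos st); rewrite e1 eqxx orbT.
  rewrite /weight e1 eqxx subnn expr0 mul1r mulr1.
  have -> : complex.Re ((x0 k * x0 l)%:C + E) = x0 k * x0 l + complex.Re E.
    by case: (E).
  have := normc_Re E; rewrite ler_norml => /andP[hh _].
  have : S k l * (x0 k * x0 l * (3 / 4)) <= S k l * (x0 k * x0 l + complex.Re E).
    rewrite ler_pM2l //; move: (x0 k * x0 l) hE hh xx0 => t; nra.
  move: (S k l) (x0 k * x0 l) ss => u v ss; nra.
have [/andP[/eqP e2 n1]|e2] := boolP ((b k + b l == n)%N && (1 < n)%N).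
  have ss := Hs (k, l); rewrite /= e2 eqxx in ss; have {}ss := ss isT.
  have S0 : 0 < S k l by apply: (stair_pos st); rewrite e2 eqxx.
  rewrite /weight (negbTE e1) e2 eqxx n1 /= subSnn expr1.
  have -> : complex.Re (d * ((x0 k * x0 l)%:C + E)) =
      x0 k * x0 l * complex.Re d + complex.Re (d * E).
    by rewrite mulrDr mulrC; case: (d) (E) => [? ?] [? ?] /=; ring.
  have := normc_Re (d * E); rewrite ler_norml normcM => /andP[hh _].
  have hd := Hd n1.
  have : S k l * (x0 k * x0 l * (normc d * (k0 * (3 / 4)))) <=
      S k l * (x0 k * x0 l * complex.Re d + complex.Re (d * E)).
    rewrite ler_pM2l //.
    have h1 : x0 k * x0 l * (k0 * normc d) <= x0 k * x0 l * complex.Re d.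
      by rewrite ler_pM2l.
    have h2 : normc d * normc E <= normc d * (3 * (k0 / 12) * (x0 k * x0 l)).
      by rewrite ler_pM2l.
    move: (x0 k * x0 l) (normc d) h1 h2 hh => t r; nra.
  have : s * (normc d * k0) <= S k l * (x0 k * x0 l) * (normc d * k0).
    by rewrite ler_pM2r // mulr_gt0.
  have := mulr_gt0 d0 k0_gt0; have := mulr_gt0 s0 (mulr_gt0 d0 k0_gt0).
  move: (S k l) (x0 k * x0 l) ss => u v; nra.
have -> : weight n b (normc d) k l = 0 by rewrite /weight (negbTE e1) (negbTE e2).
rewrite mulr0 sub0r -Re_mulC.
have := normc_Re ((S k l)%:C * (d ^+ (n.+1 - (b k + b l)) * ((x0 k * x0 l)%:C + E))).
rewrite ler_norml => /andP[+ _]; apply: le_trans; rewrite lerN2.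
have [big|small] := ltnP n.+1 (b k + b l).
  by rewrite (stair_zero st big) mul0r normc0.
rewrite !normcM normcC normcX.
have hX : normc ((x0 k * x0 l)%:C + E) <= 4 * (x0 k * x0 l).
  apply: le_trans (le_normcD _ _) _; rewrite normcC gtr0_norm //.
  by move: (x0 k * x0 l) hE xx0 => t; nra.
have [q1 q2] := exponent_ge small e1.
have hq : normc d ^+ (n.+1 - (b k + b l)) <= normc d * gap n (normc d).
  rewrite /gap; case: ifP => n1.
    rewrite -expr2; apply: ler_wiXn2l; rewrite ?(ltW d0) //.
    by apply: q2; move: e2; rewrite n1 andbT.
  by rewrite mulr1 -[leRHS]expr1; apply: ler_wiXn2l; rewrite ?(ltW d0).
have hM := HM (k, l); rewrite /= normrM (gtr0_norm xx0) in hM.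
have -> : 4 * M * normc d * gap n (normc d) = 4 * (M * (normc d * gap n (normc d))).
  by rewrite !mulrA.
apply: le_trans (_ : `|S k l| * ((normc d * gap n (normc d)) * (4 * (x0 k * x0 l))) <= _).
  apply: ler_wpM2l => //; apply: ler_pM => //; rewrite ?normc_ge0 //.
  by rewrite exprn_ge0 // normc_ge0.
rewrite [leLHS](_ : _ =
  4 * (`|S k l| * (x0 k * x0 l) * (normc d * gap n (normc d)))); last ring.
by rewrite ler_pM2l //; apply: ler_wpM2r => //; rewrite mulr_ge0 // ltW.
Qed.

(** The error terms of [energy_pointwise] are smaller by a factor r than the gap
    in [dirichlet_coercive], so they are absorbed for small r. *)
Lemma energy_coercive (k0 : R) : 0 < k0 <= 1 ->
  exists rho K r1 : R, [/\ 0 < rho <= 1, 0 < K, 0 < r1 <= 1 &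
    forall d mu c, 0 < normc d <= r1 ->
    ((1 < n)%N -> k0 * normc d <= complex.Re d) ->
    (forall k, normc (mu k - (x0 k)%:C) <= rho * x0 k) -> c ord0 = 0 ->
    K * normc d * (\sum_k nsq (c k)) <=
    \sum_k \sum_l complex.Re (scaled d k l * mu k * mu l) * nsq (c k + c l)].
Proof.
move=> k0I; have [rho [s [M [rhoI s0 M0 HP]]]] := energy_pointwise k0I.
have [K K0 HK] := dirichlet_coercive st.
pose P : R := p.+1%:R; have P0 : 0 < P by rewrite ltr0n.
pose r1 := Num.min 1 (s * K / (8 * M * P)).
have r10 : 0 < r1 by rewrite lt_min ltr01 divr_gt0 // !mulr_gt0.
exists rho, (s * K / 2), r1; split => //.
- by rewrite !mulr_gt0.
- by rewrite r10 ge_min lexx.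
move=> d mu c /andP[d0 dr1] Hd Hmu c0.
have d1 : normc d <= 1 by apply: le_trans dr1 _; rewrite ge_min lexx.
have dI : 0 < normc d <= 1 by rewrite d0.
set r := normc d in d0 d1 dr1 *; set g := gap n r; set N := \sum_k nsq (c k).
have N0 : 0 <= N by apply: sumr_ge0 => k _; exact: nsq_ge0.
have rg : r <= g by rewrite /g /gap; case: ifP.
have g0 : 0 < g by apply: lt_le_trans rg.
have rMP : 8 * M * P * r <= s * K.
  by rewrite mulrC -ler_pdivlMr ?mulr_gt0 //; apply: le_trans dr1 _;
    rewrite ge_min lexx orbT.
have hD := HK r c dI c0; rewrite -/g -/N in hD.
have hS : \sum_k \sum_l nsq (c k + c l) <= 4 * P * N.
  apply: le_trans (_ : \sum_(k < p.+1) \sum_(l < p.+1) (2 * nsq (c k) + 2 * nsq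
    (c l)) <= _).
    by apply: ler_sum => k _; apply: ler_sum => l _; exact: nsqD_le.
  rewrite (eq_bigr (fun k => 2 * P * nsq (c k) + 2 * N)); last first.
    move=> k _; rewrite big_split /= sumr_const card_ord -mulr_sumr -/N.
    by rewrite -[X in X + _]mulr_natr -/P; ring.
  rewrite big_split /= sumr_const card_ord -mulr_sumr -/N -[X in _ + X]mulr_natr -/P.
  by rewrite le_eqVlt; apply/orP; left; apply/eqP; ring.
apply: le_trans (_ : s * dirichlet n b r c - M * r * g * (4 * P * N) <= _).
  have gN : 0 <= g * N by rewrite mulr_ge0 // ltW.
  have h1 : s * (K * g * N) <= s * dirichlet n b r c by rewrite ler_pM2l.
  have h2 : 8 * M * P * r * (g * N) <= s * K * (g * N) by rewrite ler_wpM2r.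
  have h3 : (s * K) * (r * N) <= (s * K) * (g * N).
    by apply: ler_wpM2l; [rewrite ltW // mulr_gt0|apply: ler_wpM2r].
  lra.
apply: le_trans (_ : s * dirichlet n b r c - M * r * g * \sum_k \sum_l nsq (c k
  + c l) <= _).
  by rewrite lerD2l lerN2; apply: ler_wpM2l => //; rewrite ltW // !mulr_gt0.
rewrite /dirichlet !mulr_sumr -sumrB; apply: ler_sum => k _.
rewrite !mulr_sumr -sumrB; apply: ler_sum => l _.
by rewrite mulrA -mulrBl; apply: ler_wpM2r; rewrite ?nsq_ge0 // HP.
Qed.

End Energy.

(** * First-order correction of the leading profile *)

(** The range of a symmetric matrix is the annihilator of its kernel; the
    columns of the cokernel matrix supply the kernel vectors to test. *)
Lemma symmetric_solvable (F : fieldType) (q : nat) (A : 'M[F]_q) (g : 'rV[F]_q) :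
  A^T = A -> (forall h : 'rV[F]_q, h *m A = 0 -> h *m g^T = 0) ->
  exists w : 'rV[F]_q, w *m A = g.
Proof.
move=> Asym gker; suff /submxP[w ->] : (g <= A)%MS by exists w.
rewrite submxE -trmx_eq0 trmx_mul; apply/eqP/row_matrixP => i.
rewrite row_mul row0 gker // -row_mul -{2}Asym -trmx_mul mulmx_coker trmx0.
by rewrite row0.
Qed.

Section Correction.
Variables (R : realType) (n p : nat) (b : 'I_p.+1 -> nat).
Variable S : 'I_p.+1 -> 'I_p.+1 -> R.
Hypothesis st : staircase n b S.

Lemma level_le k : (b k <= n)%N.
Proof.
have [->|/(stair_level st)/andP[]//] := eqVneq k ord0.
by rewrite (stair_root st).
Qed.

Lemma sum_by_level (V : nmodType) (F : 'I_p.+1 -> V) :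
  \sum_k F k = \sum_(j < n.+1) \sum_(k | b k == j) F k.
Proof.
rewrite (partition_big (fun k => Ordinal (level_le k : (b k < n.+1)%N)) xpredT) //.
Qed.

Lemma level0 k : (b k == 0%N) = (k == ord0).
Proof.
apply/eqP/eqP => [bk|->]; last exact: stair_root st.
by apply/eqP/negPn/negP => /(stair_level st); rewrite bk.
Qed.

(** The reflection j -> n+1-j pairs the terms 1 to n and changes their sign. *)
Lemma odd_sum0 (V : zmodType) (t : nat -> V) : t 0%N = 0 ->
  (forall j, (0 < j <= n)%N -> t (n.+1 - j)%N = - t j) ->
  (\sum_(j < n.+1) t j) *+ 2 = 0.
Proof.
move=> t0 todd; rewrite big_ord_recl /= t0 add0r mulr2n.
rewrite [X in _ + X](reindex_inj rev_ord_inj) -big_split big1 //= => i _.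
by rewrite /bump /= !add1n -subSn // todd ?subrr ?ltn_ord // ltn_ord.
Qed.

Variable x0 : 'I_p.+1 -> R.
Hypothesis x0_gt0 : forall k, 0 < x0 k.
Hypothesis x0_root : x0 ord0 = 1.
Hypothesis x0_lead : forall k, k != ord0 ->
  x0 k * (\sum_(l | (b k + b l == n.+1)%N) S k l * x0 l) = 1.

(** The coefficient of the first power of the small parameter in the k-th
    equation at the leading profile x0. *)
Definition flux (k : 'I_p.+1) : R :=
  x0 k * (\sum_(l | (b k + b l == n)%N) S k l * x0 l).

Variable a : R.
Hypothesis flux_const : forall j, (j <= n)%N -> \sum_(k | b k == j) flux k = a.

Let F k l := if (b k + b l == n.+1)%N then S k l * (x0 k * x0 l) else 0.

Let F_sym k l : F k l = F l k.
Proof. by rewrite /F addnC (stair_sym st) (mulrC (x0 k)). Qed.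

Let F_ge0 k l : 0 <= F k l.
Proof.
rewrite /F; case: ifP => // e; rewrite !mulr_ge0 // ltW //.
by apply: (stair_pos st); rewrite e orbT.
Qed.

(** The leading equations say that the symmetric matrix F is stochastic, except
    for its zero row at ord0. *)
Let F_row k : \sum_l F k l = (k != ord0)%:R.
Proof.
rewrite -big_mkcond /=; have [->|k0] := eqVneq k ord0; last first.
  rewrite -(x0_lead k0) mulr_sumr; apply: eq_bigr => l _; ring.
apply: big1 => l; rewrite (stair_root st) add0n => /eqP bl.
by have := level_le l; rewrite bl ltnn.
Qed.

(** Since F is stochastic, the quadratic form of 1 + F is half the sum of F_kl
    (h_k + h_l)^2, up to the square of the value at ord0; so a kernel vector
    changes sign across every link. *)
Let F_kernel (h : 'I_p.+1 -> R) : (forall k, h k + \sum_l F k l * h l = 0) ->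
  h ord0 = 0 /\ forall k l, (b k + b l == n.+1)%N -> h k = - h l.
Proof.
move=> hk.
have energy : \sum_k \sum_l F k l * (h k + h l) ^+ 2 = - (2 * h ord0 ^+ 2).
  transitivity (\sum_k (2 * (h k * (h k + \sum_l F k l * h l))
      + (2 * (\sum_l F k l) - 2) * h k ^+ 2)); last first.
    rewrite (bigD1 ord0) //= hk !mulr0 F_row eqxx /= big1 ?addr0; first by ring.
    by move=> k k0; rewrite hk F_row k0 /=; ring.
  transitivity (\sum_k ((\sum_l F k l) * h k ^+ 2 + 2 * (h k * (\sum_l F k l * h l)))
    + \sum_k (\sum_l F k l) * h k ^+ 2); last first.
    by rewrite -big_split; apply: eq_bigr => k _ /=; ring.
  have -> : \sum_k (\sum_l F k l) * h k ^+ 2 = \sum_k \sum_l F k l * h l ^+ 2.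
    rewrite exchange_big /=; apply: eq_bigr => k _; rewrite mulr_suml.
    by apply: eq_bigr => l _; rewrite F_sym.
  rewrite -big_split; apply: eq_bigr => k _ /=.
  rewrite mulr_suml !mulr_sumr -!big_split; apply: eq_bigr => l _ /=; ring.
have pos k l : 0 <= F k l * (h k + h l) ^+ 2 by rewrite mulr_ge0 ?F_ge0 ?sqr_ge0.
have pos' k : 0 <= \sum_l F k l * (h k + h l) ^+ 2 by rewrite sumr_ge0.
have tot : \sum_k \sum_l F k l * (h k + h l) ^+ 2 = 0.
  apply/eqP; rewrite eq_le sumr_ge0 // andbT energy oppr_le0.
  by rewrite mulr_ge0 ?sqr_ge0.
split.
  by apply/eqP; rewrite -sqrf_eq0; move: energy; rewrite tot; lra.
move=> k l e; apply/eqP; rewrite -addr_eq0 -sqrf_eq0.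
have zk : \sum_l F k l * (h k + h l) ^+ 2 = 0.
  by apply: (psumr_eq0P (fun k _ => pos' k) tot).
have /eqP : F k l * (h k + h l) ^+ 2 = 0.
  by apply: (psumr_eq0P (fun l _ => pos k l) zk).
rewrite /F e mulf_eq0 => /orP[|//]; rewrite gt_eqF // !mulr_gt0 //.
by apply: (stair_pos st); rewrite e orbT.
Qed.

(** By [F_kernel] the kernel of 1 + F consists of the functions of the level
    that are odd under j -> n+1-j; a flux with the same total on each level is
    orthogonal to all of them. *)
Lemma first_order_correction : exists2 w : 'I_p.+1 -> R, w ord0 = 0 &
  forall k, k != ord0 ->
    w k + x0 k * (\sum_(l | (b k + b l == n.+1)%N) S k l * x0 l * w l) + flux k = 0.
Proof.
pose A : 'M[R]_p.+1 := \matrix_(k, l) ((k == l)%:R + F k l).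
pose g : 'rV[R]_p.+1 := \row_k (if k == ord0 then 0 else - flux k).
have Asym : A^T = A.
  by apply/matrixP => k l; rewrite !mxE F_sym eq_sym.
have hA (h : 'rV[R]_p.+1) k : (h *m A) 0 k = h 0 k + \sum_l F k l * h 0 l.
  rewrite mxE (eq_bigr (fun l => (k == l)%:R * h 0 l + F k l * h 0 l)).
    rewrite big_split /=; congr (_ + _); rewrite (bigD1 k) //= eqxx mul1r.
    by rewrite big1 ?addr0 // => l; rewrite eq_sym => /negbTE ->; rewrite mul0r.
  by move=> l _; rewrite mxE F_sym eq_sym mulrC mulrDl.
have [|w wA] := symmetric_solvable (A := A) (g := g) Asym.
  move=> h hker.
  have [h0 hodd] := @F_kernel (h 0) (fun k => etrans (esym (hA h k))
     (etrans (congr1 (fun v : 'rV[R]_p.+1 => v 0 k) hker) (mxE _ _ _ _))).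
  apply/matrixP => i j; rewrite !ord1 !mxE {i j}.
  transitivity (- \sum_k h 0 k * flux k).
    rewrite -sumrN; apply: eq_bigr => k _; rewrite !mxE.
    by case: eqVneq => [->|_]; rewrite ?h0 ?mul0r ?oppr0 // mulrN.
  have /choice[rep repP] : forall j, exists k, (j <= n)%N -> b k = j.
    by move=> j; case: (leqP j n) => [/(stair_onto st)[k]|_]; [exists k|exists ord0].
  pose t j := h 0 (rep j).
  have hb k : h 0 k = t (b k).
    have [->|k0] := eqVneq k ord0.
      rewrite /t (stair_root st); congr (h 0 _); apply/esym/eqP.
      by rewrite -level0 repP.
    have /andP[bk0 bkn] := stair_level st k0.
    have jn : (n.+1 - b k <= n)%N by lia.
    have [l bl] := stair_onto st jn.
    rewrite (hodd k l); last by apply/eqP; lia.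
    by rewrite /t (hodd (rep (b k)) l) //; apply/eqP; rewrite repP ?bl; lia.
  rewrite sum_by_level (eq_bigr (fun j : 'I_n.+1 => t j * a)); last first.
    move=> j _; rewrite -(flux_const (ltnSE (ltn_ord j))) mulr_sumr.
    by apply: eq_bigr => k /eqP bk; rewrite hb bk.
  rewrite -mulr_suml; apply/eqP; rewrite oppr_eq0 mulf_eq0; apply/orP; left.
  rewrite -[_ == 0](mulrn_eq0 _ 2) odd_sum0 //.
    rewrite /t -h0; congr (h 0 _); apply/eqP; by rewrite -level0 repP.
  move=> j /andP[j0 jn]; apply: hodd; rewrite !repP //; lia.
exists (w 0).
  by have := hA w ord0; rewrite wA mxE eqxx big1 ?addr0 // => l _; 
    rewrite /F (stair_root st) add0n ltn_eqF ?mul0r // ltnS level_le.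
move=> k k0; have := hA w k; rewrite wA mxE (negbTE k0) => e.
rewrite (_ : x0 k * _ = \sum_l F k l * w 0 l) -?e ?addNr //.
rewrite mulr_sumr big_mkcond; apply: eq_bigr => l _.
by rewrite /F; case: ifP => _; ring.
Qed.

Definition corrected (w : 'I_p.+1 -> R) (d : R[i]) (l : 'I_p.+1) : R[i] :=
  (x0 l)%:C * (1 + d * (w l)%:C).

(** The constant and the linear term in d of the k-th equation cancel by the
    leading equation and by the equation for w; what remains is O(|d|^2). *)
Lemma approximate_solution (w : 'I_p.+1 -> R) :
  (forall k, k != ord0 ->
    w k + x0 k * (\sum_(l | (b k + b l == n.+1)%N) S k l * x0 l * w l) + flux k = 0) ->
  exists2 B : R, 0 < B & forall (d : R[i]) k, normc d <= 1 -> k != ord0 ->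
    normc (corrected w d k * (\sum_l scaled n b S d k l * corrected w d l) - 1)
      <= B * normc d ^+ 2.
Proof.
move=> hw.
pose B k l := `|S k l * (x0 k * x0 l)| * ((1 + `|w k|) * (1 + `|w l|)).
have B0 k l : 0 <= B k l by rewrite !mulr_ge0 // addr_ge0.
exists (1 + \sum_k \sum_l B k l).
  by rewrite ltr_pwDl // sumr_ge0 // => k _; rewrite sumr_ge0.
move=> d k d1 k0; have d0 := normc_ge0 d.
(* the part of degree at most 1 in d of the l-th summand *)
pose main l : R[i] :=
  if (b k + b l == n.+1)%N then (S k l * (x0 k * x0 l))%:C * (1 + d * (w k + w l)%:C)
  else if (b k + b l == n)%N then (S k l * (x0 k * x0 l))%:C * d else 0.
have mainE : \sum_l main l = 1.
  pose u l := if (b k + b l == n.+1)%N then S k l * (x0 k * x0 l) else 0.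
  pose v l := if (b k + b l == n)%N then S k l * (x0 k * x0 l) else 0.
  have -> : \sum_l main l = (\sum_l u l)%:C
     + d * ((\sum_l u l) * w k + \sum_l u l * w l + \sum_l v l)%:C.
    rewrite mulr_suml -!big_split !raddf_sum mulr_sumr -big_split /=.
    apply: eq_bigr => l _; rewrite /main /u /v.
    case: ifP => [/eqP ->|_]; last case: ifP => _; last first.
    - by rewrite !mul0r !addr0 mulr0 addr0.
    - by rewrite !mul0r !add0r mulrC.
    by rewrite gtn_eqF // addr0 !rmorphD !rmorphM /=; ring.
  have -> : \sum_l u l = 1.
    rewrite -(x0_lead k0) mulr_sumr [RHS]big_mkcond; apply: eq_bigr => l _.
    by rewrite /u; case: ifP => // _; ring.
  have -> : \sum_l v l = flux k.
    rewrite /flux mulr_sumr [RHS]big_mkcond; apply: eq_bigr => l _.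
    by rewrite /v; case: ifP => // _; ring.
  have -> : \sum_l u l * w l =
      x0 k * (\sum_(l | (b k + b l == n.+1)%N) S k l * x0 l * w l).
    rewrite mulr_sumr [RHS]big_mkcond; apply: eq_bigr => l _.
    by rewrite /u; case: ifP => // _; ring.
  by rewrite mul1r hw // mulr0 addr0.
rewrite mulr_sumr -mainE -sumrB.
apply: le_trans (normc_sum _ _ _) _.
apply: le_trans (_ : \sum_l B k l * normc d ^+ 2 <= _); last first.
  rewrite -mulr_suml; apply: ler_wpM2r; first by rewrite sqr_ge0.
  rewrite [X in _ <= 1 + X](bigD1 k) //= addrCA lerDl addr_ge0 // sumr_ge0 // => i _.
  by rewrite sumr_ge0.
have w1 i : normc (1 + d * (w i)%:C) <= 1 + `|w i|.
  apply: le_trans (le_normcD _ _) _; rewrite normc1 lerD2l normcM normcC.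
  exact: ler_piMl.
apply: ler_sum => l _.
rewrite (_ : corrected w d k * (scaled n b S d k l * corrected w d l) =
  (S k l * (x0 k * x0 l))%:C *
  (d ^+ (n.+1 - (b k + b l)) * ((1 + d * (w k)%:C) * (1 + d * (w l)%:C)))); last first.
  by rewrite /corrected /scaled !rmorphM /=; ring.
set f := S k l * (x0 k * x0 l); rewrite /main -/f.
have w0 i : 0 <= `|w i| by [].
have [big|small] := ltnP n.+1 (b k + b l).
  rewrite gtn_eqF // gtn_eqF; last by lia.
  by rewrite /f (stair_zero st big) !mul0r subr0 normc0 mulr_ge0 ?B0 ?sqr_ge0.
case: (eqVneq (b k + b l)%N n.+1) => [->|e1].
  rewrite subnn expr0 mul1r (_ : _ - _ = f%:C * (d ^+ 2 * (w k * w l)%:C)); last first.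
    by rewrite rmorphD rmorphM /=; ring.
  rewrite 2!normcM normcX !normcC (normrM (w k)) mulrCA mulrC /B -/f.
  apply: ler_wpM2r; first exact: sqr_ge0.
  by apply: ler_wpM2l => //; apply: ler_pM => //; rewrite lerDr.
case: (eqVneq (b k + b l)%N n) => [->|e2].
  rewrite subSnn expr1 (_ : _ - _ =
    f%:C * (d ^+ 2 * (((w k)%:C * (1 + d * (w l)%:C)) + (w l)%:C))); last first.
    by ring.
  rewrite 2!normcM normcX normcC mulrCA mulrC /B -/f.
  apply: ler_wpM2r; first exact: sqr_ge0.
  apply: ler_wpM2l => //; apply: le_trans (le_normcD _ _) _.
  rewrite normcM !normcC.
  have : `|w k| * normc (1 + d * (w l)%:C) <= `|w k| * (1 + `|w l|) by apply: ler_wpM2l.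
  lra.
rewrite subr0 3!normcM normcC normcX /B -/f -mulrA.
apply: ler_wpM2l => //; rewrite mulrC; apply: ler_pM;
  rewrite ?mulr_ge0 ?exprn_ge0 ?normc_ge0 //.
  by apply: ler_pM; rewrite ?normc_ge0.
by apply: ler_wiXn2l => //; lia.
Qed.

End Correction.

(** * Continuity of complex polynomial expressions *)

Section ComplexContinuity.
Variables (R : realType) (T : topologicalType).

(** Continuity is required of the real and imaginary parts separately, so that
    only functions with values in R occur. *)
Definition ccontinuous (F : T -> R[i]) : Prop :=
  continuous (fun v => complex.Re (F v)) /\ continuous (fun v => complex.Im (F v)).

Lemma ccontinuous_cst z : ccontinuous (fun=> z).
Proof. by split => v; exact: cvg_cst. Qed.

Lemma ccontinuousD F G : ccontinuous F -> ccontinuous G ->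
  ccontinuous (fun v => F v + G v).
Proof.
move=> [F1 F2] [G1 G2]; split.
  rewrite (_ : (fun v => _) = (fun v => complex.Re (F v) + complex.Re (G v))).
    by move=> v; apply: cvgD; [exact: F1|exact: G1].
  by apply/funext => v; case: (F v) (G v) => [? ?] [].
rewrite (_ : (fun v => _) = (fun v => complex.Im (F v) + complex.Im (G v))).
  by move=> v; apply: cvgD; [exact: F2|exact: G2].
by apply/funext => v; case: (F v) (G v) => [? ?] [].
Qed.

Lemma ccontinuousM F G : ccontinuous F -> ccontinuous G ->
  ccontinuous (fun v => F v * G v).
Proof.
move=> [F1 F2] [G1 G2]; split.
  rewrite (_ : (fun v => _) = (fun v => complex.Re (F v) * complex.Re (G v)
      - complex.Im (F v) * complex.Im (G v))).
    move=> v; apply: cvgB.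
      by apply: cvgM; [exact: F1|exact: G1].
    by apply: cvgM; [exact: F2|exact: G2].
  by apply/funext => v; case: (F v) (G v) => [? ?] [].
rewrite (_ : (fun v => _) = (fun v => complex.Re (F v) * complex.Im (G v)
    + complex.Im (F v) * complex.Re (G v))).
  move=> v; apply: cvgD.
    by apply: cvgM; [exact: F1|exact: G2].
  by apply: cvgM; [exact: F2|exact: G1].
by apply/funext => v; case: (F v) (G v) => [? ?] [].
Qed.

Lemma ccontinuous_sum (I : finType) (F : I -> T -> R[i]) :
  (forall k, ccontinuous (F k)) -> ccontinuous (fun v => \sum_k F k v).
Proof.
move=> Fc; suff H (s : seq I) : ccontinuous (fun v => \sum_(k <- s) F k v) by exact: H.
elim: s => [|k s IH].
  rewrite (_ : (fun v => _) = fun=> 0); first exact: ccontinuous_cst.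
  by apply/funext => v; rewrite big_nil.
rewrite (_ : (fun v => _) = (fun v => F k v + \sum_(k <- s) F k v)).
  exact: ccontinuousD.
by apply/funext => v; rewrite big_cons.
Qed.

Lemma continuous_sum (I : finType) (P : pred I) (F : I -> T -> R) :
  (forall k, continuous (F k)) -> continuous (fun v => \sum_(k | P k) F k v).
Proof.
by move=> Fc; apply: continuous_big => [|k _]; [exact: add_continuous|exact: Fc].
Qed.

Lemma continuous_add (F G : T -> R) : continuous F -> continuous G ->
  continuous (fun v => F v + G v).
Proof. by move=> Fc Gc v; apply: cvgD; [exact: Fc|exact: Gc]. Qed.

Lemma continuous_exp_affine (F : T -> R) (s t : R) : continuous F ->
  continuous (fun v => s * expR (F v) - t * F v).
Proof.
move=> Fc v; apply: cvgB; last by apply: cvgM; [exact: cvg_cst|exact: Fc].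
apply: cvgM; first exact: cvg_cst.
exact: (continuous_comp (@Fc v) (@continuous_expR R _)).
Qed.

Lemma continuous_nsq F : ccontinuous F -> continuous (fun v => nsq (F v)).
Proof.
move=> [F1 F2] v; rewrite /nsq; apply: cvgD.
  by apply: cvgM; exact: F1.
by apply: cvgM; exact: F2.
Qed.

End ComplexContinuity.

(** * Stability of approximate solutions and descent of the defect *)

Section Residual.
Variables (R : realType) (n p : nat) (b : 'I_p.+1 -> nat).
Variable S : 'I_p.+1 -> 'I_p.+1 -> R.
Hypothesis st : staircase n b S.
Variable x0 : 'I_p.+1 -> R.
Hypothesis x0_gt0 : forall k, 0 < x0 k.

Definition residual (d : R[i]) (x : 'I_p.+1 -> R[i]) (k : 'I_p.+1) : R[i] :=
  x k * (\sum_l scaled n b S d k l * x l) - 1.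

Definition close (rho : R) (x : 'I_p.+1 -> R[i]) : Prop :=
  forall k, normc (x k - (x0 k)%:C) <= rho * x0 k.

Lemma normc_close rho x k : rho <= 1 -> close rho x -> normc (x k) <= 2 * x0 k.
Proof.
move=> r1 /(_ k) h; rewrite -[x k](subrK (x0 k)%:C).
apply: le_trans (le_normcD _ _) _; rewrite normcC gtr0_norm //.
by have := x0_gt0 k; nra.
Qed.

Lemma residual_lipschitz : exists2 H : R, 0 < H & forall d mu c (N : R),
  normc d <= 1 -> close 1 mu -> 0 <= N -> (forall k, normc (c k) <= N) ->
  forall k, normc (residual d (fun k => mu k * (1 + c k)) k -
                   residual d (fun k => mu k * (1 - c k)) k) <= H * N.
Proof.
pose B k l := `|S k l| * (2 * x0 k) * (2 * x0 l) * 4.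
have B0 k l : 0 <= B k l by rewrite !mulr_ge0 // ltW.
exists (1 + \sum_k \sum_l B k l).
  by rewrite ltr_pwDl // sumr_ge0 // => k _; rewrite sumr_ge0.
move=> d mu c N d1 Hmu N0 Hc k.
rewrite /residual (_ : _ - _ =
  \sum_l scaled n b S d k l * mu k * mu l * (2 * (c k + c l))); last first.
  transitivity (\sum_l (mu k * (1 + c k) * (scaled n b S d k l * (mu l * (1 + c l)))
      - mu k * (1 - c k) * (scaled n b S d k l * (mu l * (1 - c l))))).
    by rewrite sumrB -!mulr_sumr; ring.
  by apply: eq_bigr => l _; ring.
apply: le_trans (normc_sum _ _ _) _.
apply: le_trans (_ : \sum_l B k l * N <= _); last first.
  rewrite -mulr_suml; apply: ler_wpM2r => //.
  rewrite [X in _ <= 1 + X](bigD1 k) //= addrCA lerDl addr_ge0 // sumr_ge0 // => i _.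
  by rewrite sumr_ge0.
apply: ler_sum => l _; rewrite !normcM normcC normcX.
rewrite /B -!mulrA; apply: ler_wpM2l => //.
have q1 : normc d ^+ (n.+1 - (b k + b l)) <= 1 by rewrite exprn_ile1 ?normc_ge0.
have q0 : 0 <= normc d ^+ (n.+1 - (b k + b l)) by rewrite exprn_ge0 ?normc_ge0.
have hk := normc_close k (lexx 1) Hmu; have hl := normc_close l (lexx 1) Hmu.
have hc : normc (c k + c l) <= 2 * N.
  by apply: le_trans (le_normcD _ _) _; have := Hc k; have := Hc l; lra.
have n2 : normc (2 : R[i]) = 2.
  by rewrite -[2 : R[i]](rmorph_nat (real_complex R)) normcC gtr0_norm.
rewrite n2.
apply: le_trans (_ : 1 * (2 * x0 k * (2 * x0 l * (2 * (2 * N)))) <= _); last first.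
  by rewrite le_eqVlt; apply/orP; left; apply/eqP; ring.
apply: ler_pM => //; first by rewrite !mulr_ge0 ?normc_ge0.
apply: ler_pM; rewrite ?mulr_ge0 ?normc_ge0 //.
apply: ler_pM; rewrite ?mulr_ge0 ?normc_ge0 //.
by rewrite ler_pM2l.
Qed.

(** The constant 1 in the residual cancels in the difference. *)
Lemma residual_energy (d : R[i]) (mu c : 'I_p.+1 -> R[i]) :
  complex.Re (\sum_k (c k)^* *
     (residual d (fun k => mu k * (1 + c k)) k -
      residual d (fun k => mu k * (1 - c k)) k))
  = \sum_k \sum_l complex.Re (scaled n b S d k l * mu k * mu l) * nsq (c k + c l).
Proof.
rewrite -(cayley_energy _ _ (scaled_sym st d)); congr complex.Re.
by apply: eq_bigr => k _; rewrite /residual; congr (_ * _); ring.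
Qed.

Definition coercive_at (K rho : R) (d : R[i]) : Prop :=
  forall mu c, close rho mu -> c ord0 = 0 ->
    K * normc d * (\sum_k nsq (c k)) <=
    \sum_k \sum_l complex.Re (scaled n b S d k l * mu k * mu l) * nsq (c k + c l).

Lemma close_neq0 rho x k : rho < 1 -> close rho x -> x k != 0.
Proof.
move=> r1 /(_ k); apply: contraTneq => ->; rewrite sub0r normcN normcC.
by rewrite gtr0_norm // -ltNge gtr_pMl.
Qed.

(** Pair the difference of the residuals with c = (x - x')/(x + x'): coercivity
    bounds the pairing below by K |d| times the squared norm of c, and Young's
    inequality bounds it above. *)
Lemma residual_stable (K rho e : R) (d : R[i]) (x x' : 'I_p.+1 -> R[i]) :
  0 < K -> 0 < normc d -> rho < 1 -> 0 <= e -> coercive_at K rho d ->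
  close rho x -> close rho x' -> x ord0 = 1 -> x' ord0 = 1 ->
  (forall k, k != ord0 -> normc (residual d x k - residual d x' k) <= e) ->
  forall k, normc (x k - x' k) <= 4 * (p.+1%:R * e / (K * normc d)) * x0 k.
Proof.
move=> K0 d0 rho1 e0 coer xc xc' xo xo' Hres.
pose mu k := (x k + x' k) / 2; pose c k := (x k - x' k) / (x k + x' k).
have muc : close rho mu.
  move=> k; rewrite (_ : mu k - _ =
    ((x k - (x0 k)%:C) + (x' k - (x0 k)%:C)) / 2); last by rewrite /mu; field.
  rewrite normcM normcV (_ : normc 2 = 2); last first.
    by rewrite -[2 : R[i]](rmorph_nat (real_complex R)) normcC gtr0_norm.
  rewrite ler_pdivrMr //; apply: le_trans (le_normcD _ _) _.
  by have := xc k; have := xc' k; lra.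
have mu0 k : x k + x' k != 0.
  have := close_neq0 k rho1 muc; apply: contraNneq; rewrite /mu => ->.
  by rewrite mul0r.
have xE k : x k = mu k * (1 + c k) by rewrite /mu /c; field; rewrite mu0.
have xE' k : x' k = mu k * (1 - c k) by rewrite /mu /c; field; rewrite mu0.
have co : c ord0 = 0 by rewrite /c xo xo' subrr mul0r.
have := coer mu c muc co; rewrite -residual_energy.
have -> : (fun k => mu k * (1 + c k)) = x by apply/funext => k; rewrite xE.
have -> : (fun k => mu k * (1 - c k)) = x' by apply/funext => k; rewrite xE'.
set r := normc d in d0 *; set N := \sum_k nsq (c k) => HN.
have P0 : 0 < p.+1%:R :> R by rewrite ltr0n.
have Kr0 : 0 < K * r by rewrite mulr_gt0.
have up : K * r * N <= p.+1%:R * e ^+ 2 / (K * r).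
  suff : K * r * N <= K * r / 2 * N + p.+1%:R * (e ^+ 2 / (2 * (K * r))).
    rewrite (_ : p.+1%:R * (e ^+ 2 / (2 * (K * r))) =
      (p.+1%:R * e ^+ 2 / (K * r)) / 2); last first.
      by field; rewrite ?gt_eqF.
    lra.
  apply: le_trans HN _; rewrite Re_sum.
  rewrite (_ : K * r / 2 * N + _ =
      \sum_k (K * r / 2 * nsq (c k) + e ^+ 2 / (2 * (K * r)))); last first.
    by rewrite big_split /= sumr_const card_ord -mulr_sumr mulr_natl.
  apply: ler_sum => k _.
  have [->|k0] := eqVneq k ord0.
    rewrite Re_conjM co /= !mul0r addr0 addr_ge0 //.
      by rewrite mulr_ge0 ?nsq_ge0 // ltW // divr_gt0.
    by rewrite mulr_ge0 ?sqr_ge0 // invr_ge0 mulr_ge0 // ltW.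
  apply: le_trans (ler_norm _) _; apply: le_trans (normc_Re _) _.
  rewrite normcM (_ : normc (c k)^* = normc (c k));
    last by case: (c k) => u v /=; rewrite sqrrN.
  apply: le_trans (_ : normc (c k) * e <= _).
    by apply: ler_wpM2l; rewrite ?normc_ge0 ?Hres.
  rewrite nsqE -subr_ge0.
  rewrite (_ : _ - _ = (K * r * normc (c k) - e) ^+ 2 / (2 * (K * r))).
    by rewrite mulr_ge0 ?sqr_ge0 // invr_ge0 mulr_ge0 // ltW.
  by field; rewrite gt_eqF //= gt_eqF.
have Nle : N <= (p.+1%:R * e / (K * r)) ^+ 2.
  rewrite -(ler_pM2l Kr0); apply: le_trans up _.
  rewrite (_ : K * r * _ = p.+1%:R * (p.+1%:R * e ^+ 2 / (K * r))); last first.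
    by field; rewrite gt_eqF //= gt_eqF.
  rewrite -[leLHS]mul1r -!mulrA; apply: ler_wpM2r; last by rewrite ler1n.
  by rewrite !mulr_ge0 ?sqr_ge0 // ?invr_ge0 ltW.
have ck k : normc (c k) <= p.+1%:R * e / (K * r).
  rewrite -(@ler_pXn2r _ 2) ?nnegrE ?normc_ge0 //; last first.
    by rewrite divr_ge0 ?mulr_ge0 // ltW.
  rewrite -nsqE; apply: le_trans Nle; rewrite /N (bigD1 k) //= lerDl sumr_ge0 // => i _.
  exact: nsq_ge0.
move=> k; rewrite (_ : x k - x' k = 2%:C * (c k * mu k)); last first.
  by rewrite [in LHS]xE [in LHS]xE' rmorph_nat; ring.
rewrite normcM normcC gtr0_norm // normcM.
have hmu := normc_close k (ltW rho1) muc.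
apply: le_trans (_ : 2 * ((p.+1%:R * e / (K * r)) * (2 * x0 k)) <= _).
  by rewrite ler_pM2l //; apply: ler_pM; rewrite ?normc_ge0.
by rewrite le_eqVlt; apply/orP; left; apply/eqP; ring.
Qed.

Definition defect (d : R[i]) (x : 'I_p.+1 -> R[i]) : R :=
  \sum_(k | k != ord0) nsq (residual d x k).

Lemma defect_ge0 d x : 0 <= defect d x.
Proof. by apply: sumr_ge0 => k _; exact: nsq_ge0. Qed.

(** Move in the direction c = -s g, where g is the residual. By
    [residual_energy] the first-order change of the defect is at most -2 s K |d|
    times the defect, while the quadratic change is O(s^2) times the defect. *)
Lemma defect_descent (K rho eta0 eta : R) (d : R[i]) (x : 'I_p.+1 -> R[i]) :
  0 < K -> 0 < normc d <= 1 -> rho < 1 -> eta0 < eta <= rho ->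
  coercive_at K rho d -> close eta0 x -> x ord0 = 1 -> 0 < defect d x ->
  exists x', [/\ close eta x', x' ord0 = 1 & defect d x' < defect d x].
Proof.
move=> K0 /andP[d0 d1] rho1 /andP[eta01 eta_rho] coer xc xo defx.
have [H H0 HH] := residual_lipschitz.
pose g k := if k == ord0 then 0 else residual d x k.
pose M := 1 + \sum_k normc (g k).
have gM k : normc (g k) <= M.
  by rewrite /M (bigD1 k) //= addrCA lerDl addr_ge0 // sumr_ge0 // => i _;
    exact: normc_ge0.
have M0 : 0 < M by rewrite ltr_pwDl // sumr_ge0 // => i _; exact: normc_ge0.
have N0 := defect_ge0 d x.
have NE : \sum_k nsq (g k) = defect d x.
  rewrite /defect [RHS]big_mkcond; apply: eq_bigr => k _; rewrite /g.
  by case: eqVneq => //= _; rewrite /nsq /= expr0n addr0.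
pose P : R := p.+1%:R; have P0 : 0 < P by rewrite ltr0n.
(* the three terms keep the Cayley transform invertible, keep x' within eta of
   the profile, and make the quadratic term smaller than the gain *)
pose s := Num.min (1 / 2 / M)
  (Num.min ((eta - eta0) / 8 / M) (K * normc d / (P * H ^+ 2))).
have s0 : 0 < s.
  by rewrite !lt_min !divr_gt0 ?mulr_gt0 ?exprn_gt0 // subr_gt0.
have s1 : s * M <= 1 / 2.
  by rewrite -ler_pdivlMr // ge_min lexx.
have s2 : s * M <= (eta - eta0) / 8.
  by rewrite -ler_pdivlMr // ge_min [X in _ || X]ge_min lexx orbT.
have s3 : s * (P * H ^+ 2) <= K * normc d.
  by rewrite -ler_pdivlMr ?mulr_gt0 ?exprn_gt0 // ge_min [X in _ || X]ge_min lexx !orbT.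
clearbody s.
pose c k := (- s)%:C * g k.
have cM k : normc (c k) <= s * M.
  by rewrite normcM normcC normrN gtr0_norm // ler_pM2l.
have c1 k : 1 - c k != 0.
  apply: contraTneq (cM k) => /eqP; rewrite subr_eq0 => /eqP <-.
  by rewrite normc1 -ltNge; lra.
have co : c ord0 = 0 by rewrite /c /g eqxx mulr0.
pose mu k := x k / (1 - c k); pose x' k := mu k * (1 + c k).
have xE : (fun k => mu k * (1 - c k)) = x.
  by apply/funext => k; rewrite /mu divfK.
have eta0_1 : eta0 <= 1 by lra.
have normc_mu k : normc (mu k) <= 4 * x0 k.
  rewrite /mu normcM normcV ler_pdivrMr ?normc_gt0 //.
  have hx := normc_close k eta0_1 xc.
  have : 1 <= normc (1 - c k) + normc (c k).
    by rewrite -[leLHS]normc1 -{1}(subrK (c k) 1) le_normcD.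
  by have := cM k; have := x0_gt0 k; nra.
have x'c : close eta x'.
  move=> k; rewrite (_ : x' k - _ = (x k - (x0 k)%:C) + 2%:C * (c k * mu k)); last first.
    by rewrite -{1}xE /x' rmorph_nat; ring.
  apply: le_trans (le_normcD _ _) _; rewrite normcM normcC gtr0_norm // normcM.
  have : normc (c k) * normc (mu k) <= (eta - eta0) / 8 * (4 * x0 k).
    by apply: ler_pM; rewrite ?normc_ge0 //; apply: le_trans (cM k) s2.
  by have := xc k; lra.
have muc : close rho mu.
  move=> k; rewrite (_ : mu k - _ =
    ((x k - (x0 k)%:C) + (x' k - (x0 k)%:C)) / 2%:C); last first.
    by rewrite -{1}xE /x' rmorph_nat; field.
  rewrite normcM normcV normcC gtr0_norm // ler_pdivrMr //.
  apply: le_trans (le_normcD _ _) _.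
  have := xc k; have := x'c k; have := x0_gt0 k.
  have : eta * x0 k <= rho * x0 k by rewrite ler_wpM2r // ltW.
  have : eta0 * x0 k <= rho * x0 k by rewrite ler_wpM2r ?ltW //; lra.
  lra.
exists x'; split => //; first by rewrite /x' /mu co subr0 addr0 invr1 xo !mulr1.
have := coer mu c muc co; rewrite -residual_energy xE.
have -> : (fun k => mu k * (1 + c k)) = x' by [].
have cN : \sum_k nsq (c k) = s ^+ 2 * defect d x.
  rewrite -NE mulr_sumr; apply: eq_bigr => k _.
  by rewrite !nsqE normcM normcC normrN gtr0_norm // exprMn.
rewrite cN => coer'.
pose D k := residual d x' k - residual d x k.
have DN k : nsq (D k) <= H ^+ 2 * (s ^+ 2 * defect d x).
  have := HH d mu c (Num.sqrt (\sum_k nsq (c k))) d1 _ (sqrtr_ge0 _) _ k.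
  rewrite xE -/x' -/(D k) => h.
  have : normc (D k) <= H * Num.sqrt (\sum_k nsq (c k)).
    apply: h.
      move=> i; apply: le_trans (muc i) _; apply: ler_wpM2r; rewrite ltW //.
    move=> i; rewrite -[leLHS]ger0_norm ?normc_ge0 // -sqrtr_sqr ler_wsqrtr // -nsqE.
    by rewrite (bigD1 i) //= lerDl sumr_ge0 // => j _; exact: nsq_ge0.
  rewrite -(@ler_pXn2r _ 2) ?nnegrE ?normc_ge0 //; last first.
    by rewrite mulr_ge0 ?sqrtr_ge0 // ltW.
  by rewrite -nsqE exprMn sqr_sqrtr cN // mulr_ge0 ?sqr_ge0.
have -> : defect d x' = defect d x +
    2 * (\sum_k complex.Re ((g k)^* * D k)) + \sum_(k | k != ord0) nsq (D k).
  rewrite mulr_sumr [\sum_k _](bigD1 ord0) //= Re_conjM {1 2}/g eqxx /= !mul0r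
    addr0 mulr0 add0r.
  rewrite /defect -!big_split; apply: eq_bigr => k k0 /=.
  rewrite /g (negbTE k0) Re_conjM {2 3}/nsq /D.
  case: (residual d x' k) (residual d x k) => [u v] [u' v']; rewrite /nsq /=; ring.
have -> : \sum_k complex.Re ((g k)^* * D k) =
   - s^-1 * complex.Re (\sum_k (c k)^* * (residual d x' k - residual d x k)).
  rewrite Re_sum mulr_sumr; apply: eq_bigr => k _; rewrite -/(D k) !Re_conjM /c.
  by case: (g k) => u v /=; field; rewrite gt_eqF.
have le1 : \sum_(k | k != ord0) nsq (D k) <= P * (H ^+ 2 * (s ^+ 2 * defect d x)).
  apply: le_trans (_ : \sum_(k < p.+1) H ^+ 2 * (s ^+ 2 * defect d x) <= _).
    rewrite big_mkcond; apply: ler_sum => k _; case: ifP => // _.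
    by rewrite mulr_ge0 ?sqr_ge0 // mulr_ge0 ?sqr_ge0.
  by rewrite sumr_const card_ord -mulr_natl.
have le2 : s^-1 * (K * normc d * (s ^+ 2 * defect d x)) <=
   s^-1 * complex.Re (\sum_k (c k)^* * (residual d x' k - residual d x k)).
  by rewrite ler_wpM2l // invr_ge0 ltW.
rewrite (_ : s^-1 * (K * normc d * (s ^+ 2 * defect d x)) =
  s * (K * normc d * defect d x)) in le2; last first.
  by field; rewrite gt_eqF.
have le3 : s * (P * H ^+ 2) * (s * defect d x) <= K * normc d * (s * defect d x).
  by apply: ler_wpM2r => //; rewrite mulr_ge0 // ltW.
have pos : 0 < s * (K * normc d * defect d x) by rewrite !mulr_gt0.
move: le1 le2; set A := complex.Re _; set B := \sum_(k | _) _ => le1 le2.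
rewrite mulNr; lra.
Qed.

End Residual.

(** * Existence of a solution near the leading profile *)

Section LocalSolution.
Variables (R : realType) (n p : nat) (b : 'I_p.+1 -> nat).
Variable S : 'I_p.+1 -> 'I_p.+1 -> R.
Hypothesis st : staircase n b S.
Variable x0 : 'I_p.+1 -> R.
Hypothesis x0_gt0 : forall k, 0 < x0 k.
Hypothesis x0_root : x0 ord0 = 1.
Hypothesis x0_lead : forall k, k != ord0 ->
  x0 k * (\sum_(l | (b k + b l == n.+1)%N) S k l * x0 l) = 1.
Variable a : R.
Hypothesis flux_const : forall j, (j <= n)%N ->
  \sum_(k | b k == j) flux n b S x0 k = a.

(** Real coordinates for the points of the box; the value at ord0 is frozen to
    1. *)
Definition around (v : 'rV[R]_(p.+1 + p.+1)) (k : 'I_p.+1) : R[i] :=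
  if k == ord0 then 1 else
  (x0 k)%:C * (1 + (v 0 (lshift p.+1 k) +i* v 0 (rshift p.+1 k))).

Lemma around_close (L : R) (v : 'rV[R]_(p.+1 + p.+1)) :
  0 <= L -> (forall i, `|v 0 i| <= L) -> close x0 (2 * L) (around v).
Proof.
move=> L0 vL k; rewrite /around; case: eqVneq => [->|k0].
  by rewrite x0_root subrr normc0 mulr1 mulr_ge0.
rewrite mulrDr mulr1 addrAC subrr add0r normcM normcC gtr0_norm // mulrC.
rewrite ler_pM2r //; apply: le_trans (normc_ReIm _) _ => /=.
by have := vL (lshift p.+1 k); have := vL (rshift p.+1 k); lra.
Qed.

Lemma around_onto (L : R) x : 0 <= L -> close x0 L x -> x ord0 = 1 ->
  exists2 v : 'rV[R]_(p.+1 + p.+1), (forall i, `|v 0 i| <= L) & around v = x.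
Proof.
move=> L0 xc xo.
pose h k := x k / (x0 k)%:C - 1.
have x0C k : (x0 k)%:C != 0 :> R[i].
  by rewrite -normc_gt0 normcC normr_gt0 gt_eqF.
have hL k : normc (h k) <= L.
  rewrite /h -(mulfV (x0C k)) -mulrBl normcM normcV normcC gtr0_norm //.
  by rewrite ler_pdivrMr.
exists (row_mx (\row_k complex.Re (h k)) (\row_k complex.Im (h k))).
  move=> i; rewrite mxE; case: splitP => k _; rewrite mxE.
    by apply: le_trans (normc_Re _) _.
  by apply: le_trans (normc_Im _) _.
apply/funext => k; rewrite /around row_mxEl row_mxEr !mxE.
case: eqVneq => [->//|k0]; rewrite (_ : _ +i* _ = h k); last by case: (h k).
by rewrite /h addrC subrK mulrCA mulfV // mulr1.
Qed.

Lemma defect_around_continuous d :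
  continuous (fun v => defect n b S d (around v)).
Proof.
have yc k : ccontinuous (fun v => around v k).
  rewrite /around; case: eqVneq => _; first exact: ccontinuous_cst.
  apply: ccontinuousM; first exact: ccontinuous_cst.
  apply: ccontinuousD; first exact: ccontinuous_cst.
  by split => /=; exact: coord_continuous.
apply: continuous_sum => k; apply: continuous_nsq.
apply: ccontinuousD; last exact: ccontinuous_cst.
apply: ccontinuousM => //; apply: ccontinuous_sum => l.
by apply: ccontinuousM => //; exact: ccontinuous_cst.
Qed.

(** Minimise the defect over the box of half-side L around x0. The corrected
    profile lies in the box and has residual O(r^2), hence so does the
    minimiser, and [residual_stable] puts the two at distance O(r^2 / r) = O(r)
    from each other. For small r the minimiser is thus interior, and
    [defect_descent] forbids a positive defect. *)
Theorem local_solution (k0 rho : R) : 0 < k0 <= 1 -> 0 < rho ->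
  exists2 r : R, 0 < r & forall d : R[i], 0 < normc d < r ->
    ((1 < n)%N -> k0 * normc d <= complex.Re d) ->
    exists x, [/\ x ord0 = 1, forall k, k != ord0 -> residual n b S d x k = 0 &
      close x0 rho x].
Proof.
move=> k0I rho_gt0.
have [rho1 [K [r1 [/andP[rho1_gt0 rho1_le1] K0 /andP[r1_gt0 r1_le1] HE]]]] :=
  energy_coercive st x0_gt0 k0I.
have [w wo Hw] := first_order_correction st x0_gt0 x0_lead flux_const.
have [B B0 HB] := approximate_solution st x0_lead Hw.
have [A A0 HA] := fin_upper_bound w.
(* coordinates bounded by L give a relative distance at most 2 L, which must
   stay below rho, below the coercivity radius and below 1 *)
pose L := Num.min rho rho1 / 4.
have L0 : 0 < L by rewrite divr_gt0 // lt_min rho_gt0.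
have Lrho : 4 * L <= rho by rewrite /L mulrC divfK ?pnatr_eq0 // ge_min lexx.
have Lrho1 : 4 * L <= rho1 by rewrite /L mulrC divfK ?pnatr_eq0 // ge_min lexx orbT.
clearbody L.
pose P : R := p.+1%:R; have P1 : 1 <= P by rewrite ler1n.
have P0 : 0 < P by rewrite ltr0n.
pose G := 4 * (P * (2 * P * B) / K).
have G0 : 0 < G by rewrite mulr_gt0 // divr_gt0 // !mulr_gt0.
exists (Num.min r1 (L / (2 * (G + A)))).
  by rewrite lt_min r1_gt0 divr_gt0 // mulr_gt0 // addr_gt0.
move=> d /andP[d0]; rewrite lt_min => /andP[dr1 drL] Hd.
have {}drL : 2 * (G + A) * normc d < L.
  by rewrite mulrC -ltr_pdivlMr // mulr_gt0 // addr_gt0.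
have d1 : normc d <= 1 by apply: le_trans (ltW dr1) r1_le1.
set r := normc d in d0 d1 dr1 drL.
have coer : coercive_at n b S x0 K (2 * L) d.
  move=> mu c muc co; apply: HE => //; rewrite ?d0 ?(ltW dr1) //.
  by move=> k; apply: le_trans (muc k) _; rewrite ler_pM2r //; lra.
have [v vL vmin] := box_min (ltW L0) (@defect_around_continuous d).
pose x := around v; exists x.
have xo : x ord0 = 1 by rewrite /x /around eqxx.
have xc : close x0 (2 * L) x by apply: around_close (ltW L0) vL.
split=> //; last by move=> k; apply: le_trans (xc k) _; rewrite ler_pM2r //; lra.
pose x1 := corrected x0 w d.
have x1o : x1 ord0 = 1 by rewrite /x1 /corrected x0_root wo mulr0 addr0 mulr1.
have x1A k : normc (x1 k - (x0 k)%:C) <= A * r * x0 k.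
  rewrite /x1 /corrected mulrDr mulr1 addrAC subrr add0r !normcM !normcC.
  rewrite gtr0_norm // mulrC ler_pM2r // mulrC.
  by apply: ler_wpM2r; [exact: ltW|exact: HA].
have Gr0 : 0 < G * r by rewrite mulr_gt0.
have Ar0 : 0 < A * r by rewrite mulr_gt0.
have x1c : close x0 L x1.
  by move=> k; apply: le_trans (x1A k) _; rewrite ler_pM2r //; lra.
have [u uL ux1] := around_onto (ltW L0) x1c x1o.
have x1B k : k != ord0 -> normc (residual n b S d x1 k) <= B * r ^+ 2.
  by move=> kn0; apply: HB.
have x1D : defect n b S d x1 <= (P * (B * r ^+ 2)) ^+ 2.
  apply: le_trans (_ : \sum_(k < p.+1) (B * r ^+ 2) ^+ 2 <= _).
    rewrite /defect big_mkcond; apply: ler_sum => k _; case: ifP => [kn0|_];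
      last exact: sqr_ge0.
    rewrite nsqE ler_pXn2r ?nnegrE ?normc_ge0 ?x1B //.
    by rewrite mulr_ge0 ?sqr_ge0 // ltW.
  rewrite sumr_const card_ord -[leLHS]mulr_natl [leRHS]exprMn; apply: ler_wpM2r;
    first exact: sqr_ge0.
  by rewrite -/P expr2; apply: ler_peMl => //; exact: ltW.
have xB k : k != ord0 -> normc (residual n b S d x k) <= P * (B * r ^+ 2).
  move=> kn0; rewrite -(@ler_pXn2r _ 2) ?nnegrE ?normc_ge0 //; last first.
    by rewrite !mulr_ge0 ?ltW // exprn_gt0.
  apply: le_trans x1D; rewrite -ux1; apply: le_trans (vmin _ uL).
  by rewrite -nsqE /defect (bigD1 k) //= lerDl sumr_ge0 // => i _; exact: nsq_ge0.
have x1c' : close x0 (2 * L) x1.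
  by move=> k; apply: le_trans (x1c k) _; rewrite ler_pM2r //; lra.
have L1 : 2 * L < 1 by lra.
have e0 : 0 <= 2 * P * (B * r ^+ 2) by rewrite !mulr_ge0 ?ltW // exprn_gt0.
have stab : forall k, normc (x k - x1 k) <=
    4 * (p.+1%:R * (2 * P * (B * r ^+ 2)) / (K * r)) * x0 k.
  apply: (residual_stable st x0_gt0 K0 d0 L1 e0 coer xc x1c' xo x1o) => k kn0.
  apply: le_trans (le_normcD _ _) _; rewrite normcN.
  have := xB k kn0; have := x1B k kn0.
  have : 0 <= B * r ^+ 2 by rewrite mulr_ge0 ?ltW // exprn_gt0.
  by move: (B * _) P1 => t P1 t0 h1 h2; nra.
have xc0 : close x0 ((G + A) * r) x.
  move=> k; rewrite -(subrK (x1 k) (x k)) -addrA; apply: le_trans (le_normcD _ _) _.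
  have := stab k; rewrite -/P (_ : 4 * (_ / _) = G * r); last first.
    by rewrite /G; field; rewrite !gt_eqF.
  by have := x1A k; lra.
have [D0|Dn] := eqVneq (defect n b S d x) 0.
  move=> k kn0; apply/eqP; rewrite -normc_eq0 -sqrf_eq0 -nsqE; apply/eqP.
  by apply: (psumr_eq0P _ D0) => // i _; exact: nsq_ge0.
have Dp : 0 < defect n b S d x by rewrite lt_neqAle eq_sym Dn defect_ge0.
have dI : 0 < normc d <= 1 by rewrite d0.
have etaI : (G + A) * r < L <= 2 * L by apply/andP; split; lra.
have [x' [x'c x'o x'D]] := defect_descent st x0_gt0 K0 dI L1 etaI coer xc0 xo Dp.
have [v' v'L v'x] := around_onto (ltW L0) x'c x'o.
by have := vmin v' v'L; rewrite v'x leNgt x'D.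
Qed.

End LocalSolution.

(** * Sinkhorn scaling on the dominant anti-diagonal *)

Lemma first_variation0 (R : realType) (D E e : R) : 0 < e -> 0 <= E ->
  (forall t, `|t| <= e -> 0 <= t * D + t ^+ 2 * E) -> D = 0.
Proof.
move=> e0 E0 H; apply/eqP/negPn/negP => Dn.
have D0 : 0 < `|D| by rewrite normr_gt0.
pose u := Num.min (e / `|D|) (1 / (2 * (1 + E))).
have u0 : 0 < u by rewrite lt_min !divr_gt0 // mulr_gt0 // ltr_wpDr.
have u1 : u * `|D| <= e by rewrite -ler_pdivlMr // ge_min lexx.
have u2 : u * (2 * (1 + E)) <= 1.
  by rewrite -ler_pdivlMr ?ge_min ?lexx ?orbT // mulr_gt0 // ltr_wpDr.
have := H (- (u * D)); rewrite normrN normrM gtr0_norm // => /(_ u1).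
have : 0 < u * D ^+ 2 by rewrite mulr_gt0 // exprn_even_gt0.
have -> : - (u * D) * D + (- (u * D)) ^+ 2 * E = u * D ^+ 2 * (u * E - 1) by ring.
by move=> h; rewrite pmulr_rge0 // => h2; nra.
Qed.

Lemma expR_sub1_le (R : realType) (u : R) : `|u| <= 1 / 2 ->
  expR u - 1 <= u + 2 * u ^+ 2.
Proof.
rewrite ler_norml => /andP[u1 u2].
have h : expR u <= (1 - u)^-1.
  rewrite -[u in expR u]opprK expRN lef_pV2 ?posrE ?expR_gt0 //; last lra.
  exact: expR_ge1Dx.
rewrite lerBlDr; apply: le_trans h _; rewrite invf_ple ?posrE; [|lra|nra].
rewrite -[leLHS]mul1r ler_pdivrMr; last nra.
nra.
Qed.

(** For y >= 0 the inequality exp(y) >= (y/2)^2 leaves a perfect square; for y <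
    0 the exponential is dropped. *)
Lemma sinkhorn_term_lower (R : realType) (s tau y : R) : 0 < s -> 0 < tau ->
  tau * `|y| - 4 * tau ^+ 2 / s <= s * expR y - tau * y.
Proof.
move=> s0 tau0; have q0
  : 0 < 4 * tau ^+ 2 / s by rewrite divr_gt0 // mulr_gt0 // exprn_gt0.
case: (ger0P y) => y0; last by have := mulr_gt0 s0 (expR_gt0 y); lra.
have : (y / 2) ^+ 2 <= expR y.
  rewrite {2}(splitr y) expRD -expr2 ler_pXn2r ?nnegrE ?expR_ge0 ?divr_ge0 //.
  by have := expR_ge1Dx (y / 2); lra.
move=> /(ler_wpM2l (ltW s0)) h.
have : 0 <= (s * y / 2 - 2 * tau) ^+ 2 / s by rewrite divr_ge0 ?sqr_ge0 // ltW.
rewrite (_ : _ / s = s * (y / 2) ^+ 2 - 2 * tau * y + 4 * tau ^+ 2 / s); first lra.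
by field; rewrite gt_eqF.
Qed.

Section Sinkhorn.
Variables (R : realType) (n p N : nat) (b : 'I_p.+1 -> nat).
Variable S : 'I_p.+1 -> 'I_p.+1 -> R.
Hypothesis st : staircase n b S.
Hypothesis N_gt0 : (0 < N)%N.
Hypothesis card_level : forall j, (0 < j <= n)%N -> #|[pred k | b k == j]| = N.

Let linked k l := (b k + b l == n.+1)%N.

Let linked_sym k l : linked k l = linked l k.
Proof. by rewrite /linked addnC. Qed.

Let S_gt0 k l : linked k l -> 0 < S k l.
Proof. by move=> e; apply: (stair_pos st); rewrite -/(linked k l) e orbT. Qed.

Let tau : R := N%:R^-1.
Let tau_gt0 : 0 < tau. Proof. by rewrite invr_gt0 ltr0n. Qed.

Let term (y : 'I_p.+1 -> R) k l : R :=
  if linked k l then S k l * expR (y k + y l) - tau * (y k + y l) else 0.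

Let J (y : 'I_p.+1 -> R) : R := \sum_k \sum_l term y k l.

Let slack k l : R := if linked k l then 4 * tau ^+ 2 / S k l else 0.

Let term_ge y k l : - slack k l <= term y k l.
Proof.
rewrite /term /slack; case: ifP => [e|_]; last by rewrite oppr0.
apply: le_trans (sinkhorn_term_lower _ (S_gt0 e) tau_gt0).
by rewrite lerDr mulr_ge0 // ltW.
Qed.

Let total_slack := \sum_k \sum_l slack k l.

Let J_coercive y k l : linked k l -> tau * `|y k + y l| <= J y + total_slack.
Proof.
move=> e; have pos i j : 0 <= term y i j + slack i j by have := term_ge y i j; lra.
have -> : J y + total_slack = \sum_i \sum_j (term y i j + slack i j).
  by rewrite /J /total_slack -big_split; apply: eq_bigr => i _; rewrite big_split.
apply: le_trans (_ : term y k l + slack k l <= _).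
  rewrite /term /slack e.
  by have := sinkhorn_term_lower (y k + y l) (S_gt0 e) tau_gt0; lra.
rewrite (bigD1 k) //= (bigD1 l) //= -addrA lerDl addr_ge0 //; apply: sumr_ge0 => i _ //.
by apply: sumr_ge0.
Qed.

(** The functional depends on y only through the sums over linked pairs. Adding
    a constant to level j and subtracting it from level n+1-j changes none of
    them, so the values at one representative of level j and one of level n+1-j
    can be made equal; then every single value is controlled by the sums. *)
Let J_normalize (y : 'I_p.+1 -> R) (L : R) : 0 <= L ->
  (forall k l, linked k l -> `|y k + y l| <= L) ->
  exists y', (forall k, `|y' k| <= 2 * L) /\ J y' = J y.
Proof.
move=> L0 yL.
have /choice[rep repP] : forall j, exists k, (j <= n)%N -> b k = j.
  by move=> j; case: (leqP j n) => [/(stair_onto st)[k]|_]; [exists k|exists ord0].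
pose shift j := (y (rep j) - y (rep (n.+1 - j)%N)) / 2.
pose y' k := if k == ord0 then 0 else y k - shift (b k).
exists y'; split.
  move=> k; rewrite /y'; case: eqVneq => [_|k0]; first by rewrite normr0 mulr_ge0.
  have := stair_level st k0; move bk: (b k) => j /andP[j0 jn].
  have e1 : linked k (rep (n.+1 - j)%N) by apply/eqP; rewrite bk repP; lia.
  have e2 : linked (rep j) (rep (n.+1 - j)%N) by apply/eqP; rewrite !repP //; lia.
  have := yL _ _ e1; have := yL _ _ e2; rewrite /shift !ler_norml.
  by move=> /andP[? ?] /andP[? ?]; apply/andP; split; lra.
have sums k l : linked k l -> y' k + y' l = y k + y l.
  move=> e; have nk : k != ord0.
    apply/eqP => k0; move: e; rewrite /linked k0 (stair_root st) add0n => /eqP bl.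
    by have := level_le st l; rewrite bl ltnn.
  have nl : l != ord0.
    apply/eqP => k0; move: e; rewrite /linked k0 (stair_root st) addn0 => /eqP bl.
    by have := level_le st k; rewrite bl ltnn.
  rewrite /y' (negbTE nk) (negbTE nl) /shift.
  have -> : (n.+1 - b k = b l)%N by move/eqP: e; lia.
  have -> : (n.+1 - b l = b k)%N by move/eqP: e; lia.
  lra.
by apply: eq_bigr => k _; apply: eq_bigr => l _; rewrite /term;
  case: ifP => // e; rewrite sums.
Qed.

Let J_minimizer : exists y, forall y', J y <= J y'.
Proof.
pose L := (J (fun=> 0) + total_slack) / tau.
have L0 : 0 <= L.
  rewrite divr_ge0 //; last exact: ltW.
  rewrite /J /total_slack -big_split; apply: sumr_ge0 => k _ /=.
  by rewrite -big_split; apply: sumr_ge0 => l _ /=; have := term_ge (fun=> 0) k l; lra.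
have Jc : continuous (fun v : 'rV[R]_p.+1 => J (v 0)).
  apply: continuous_sum => k; apply: continuous_sum => l.
  rewrite /term; case: (linked k l); last exact: cst_continuous.
  apply: continuous_exp_affine.
  by apply: continuous_add; exact: coord_continuous.
have [v vL vmin] := box_min (mulr_ge0 (ler0n R 2) L0) Jc.
exists (v 0) => y'.
have v00 : J (v 0) <= J (fun=> 0).
  have := vmin 0; rewrite (_ : (0 : 'rV_p.+1) 0 = fun=> 0);
    last by apply/funext => i; rewrite mxE.
  by apply=> i; rewrite normr0 mulr_ge0.
have [big|small] := leP (J (fun=> 0)) (J y'); first exact: le_trans v00 big.
have [|y'' [y''L <-]] := @J_normalize y' L L0.
  move=> k l e; rewrite /L ler_pdivlMr // mulrC; apply: le_trans (J_coercive y' e) _.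
  by rewrite lerD2r ltW.
have := vmin (\row_k y'' k); rewrite (_ : (\row_k y'' k) 0 = y'');
  last by apply/funext => i; rewrite mxE.
by apply=> i; exact: y''L.
Qed.

(** The functional sum (S_kl exp(y_k + y_l) - (y_k + y_l)/N) over linked pairs
    has a minimiser, and its derivative in the direction of the k-th coordinate
    is twice the k-th equation because each k is linked to N indices. *)
Lemma sinkhorn : exists x : 'I_p.+1 -> R,
  [/\ forall k, 0 < x k, x ord0 = 1 & forall k, k != ord0 ->
    x k * (\sum_(l | (b k + b l == n.+1)%N) S k l * x l) = 1].
Proof.
have [y ymin] := J_minimizer.
pose x k := if k == ord0 then 1 else expR (y k).
have x_gt0 k : 0 < x k.
  by rewrite /x; case: ifP => _; [exact: ltr01|exact: expR_gt0].
exists x; split => //.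
move=> k k0.
pose A i j := if linked i j then S i j * expR (y i + y j) - tau else 0.
have A_sym i j : A i j = A j i by rewrite /A linked_sym (stair_sym st) (addrC (y i)).
pose h (i : 'I_p.+1) : R := (i == k)%:R.
have hI i : 0 <= h i <= 1 by rewrite /h; case: eqP => _; rewrite lexx ler01.
have Ah : \sum_i \sum_j A i j * (h i + h j) = 2 * \sum_j A k j.
  transitivity (\sum_i (\sum_j A i j) * h i + \sum_i \sum_j A i j * h j).
    rewrite -big_split; apply: eq_bigr => i _; rewrite mulr_suml -big_split.
    by apply: eq_bigr => j _; rewrite mulrDr.
  rewrite [X in _ + X]exchange_big /=.
  rewrite [X in _ + X](eq_bigr (fun i => (\sum_j A i j) * h i)); last first.
    by move=> i _; rewrite mulr_suml; apply: eq_bigr => j _; rewrite A_sym.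
  suff -> : \sum_i (\sum_j A i j) * h i = \sum_j A k j by ring.
  rewrite (bigD1 k) //= [X in _ + X]big1; last first.
    by move=> i ik; rewrite /h (negbTE ik) mulr0.
  by rewrite /h eqxx mulr1 addr0.
have Ak : \sum_j A k j = 0.
  pose E := \sum_i \sum_j (if linked i j then 8 * (S i j * expR (y i + y j)) else 0).
  suff : \sum_i \sum_j A i j * (h i + h j) = 0 by rewrite Ah; lra.
  apply: (@first_variation0 _ _ E (1 / 4)) => //.
    apply: sumr_ge0 => i _; apply: sumr_ge0 => j _; case: ifP => // e.
    by rewrite mulr_ge0 // mulr_ge0 ?expR_ge0 // ltW // S_gt0.
  move=> t tI; have := ymin (fun i => y i + t * h i);
    rewrite -subr_ge0 => /le_trans; apply.
  rewrite /J /E -sumrB !mulr_sumr -big_split; apply: ler_sum => i _ /=.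
  rewrite -sumrB !mulr_sumr -big_split; apply: ler_sum => j _ /=.
  rewrite /term /A; case: ifP => e; last by rewrite subrr mul0r !mulr0 addr0.
  have := S_gt0 e; set s := S i j => s0.
  rewrite (_ : y i + t * h i + (y j + t * h j) = (y i + y j) + t * (h i + h j));
    last ring.
  rewrite expRD; set u := t * (h i + h j).
  have /andP[hi0 hi1] := hI i; have /andP[hj0 hj1] := hI j.
  have uI : `|u| <= 1 / 2.
    rewrite /u normrM (ger0_norm (addr_ge0 hi0 hj0)).
    apply: le_trans (_ : 1 / 4 * 2 <= _); last lra.
    by apply: ler_pM => //; [rewrite addr_ge0|lra].
  have u2 : u ^+ 2 <= 4 * t ^+ 2.
    rewrite /u exprMn mulrC; apply: ler_wpM2r; first exact: sqr_ge0.
    by nra.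
  have := expR_sub1_le uI => he.
  have ss : 0 < s * expR (y i + y j) by rewrite mulr_gt0 ?expR_gt0.
  have h1 := ler_wpM2l (ltW ss) he; have h2 := ler_wpM2l (ltW ss) u2.
  rewrite (_ : t * _ = (s * expR (y i + y j) - tau) * u); last by rewrite /u; ring.
  by rewrite [s * (_ * _)]mulrA; move: (s * expR (y i + y j)) h1 h2 => W; lra.
have /card_level : (0 < n.+1 - b k <= n)%N.
  by have := stair_level st k0; lia.
move=> cardN; have : \sum_j A k j =
  x k * (\sum_(l | linked k l) S k l * x l) - tau * N%:R.
  rewrite /A -big_mkcond /= sumrB mulr_sumr; congr (_ - _).
    apply: eq_bigr => l e; rewrite /x (negbTE k0) expRD.
    have -> : (l == ord0) = false.
      apply/eqP => l0; move: e; rewrite /linked l0 (stair_root st) addn0 => /eqP bk.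
      by have := level_le st k; rewrite bk ltnn.
    by ring.
  rewrite sumr_const mulr_natr -cardN; congr (_ *+ _); apply: eq_card => l.
  rewrite !inE /in_mem /= /linked; have := level_le st k.
  by move=> bk; apply/eqP/eqP; lia.
rewrite Ak mulVf ?pnatr_eq0 -?lt0n // => /esym/eqP; rewrite subr_eq0 => /eqP. by [].
Qed.

End Sinkhorn.

(** * Balancing the levels and bounding the leading profile *)

Lemma root_exists (R : realType) (m : nat) (q : R) : 0 < q ->
  exists2 r : R, 0 < r & r ^+ m.+1 = q.
Proof.
move=> q0; exists (expR (ln q / m.+1%:R)); first exact: expR_gt0.
by rewrite -expRM_natr divfK ?pnatr_eq0 // lnK.
Qed.

(** Dividing the relation X_j X_(n-j) ~ a by X_(j+1) X_(n-j) ~ 1 shows that X_j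
    a^j is within K^(2j) of 1. At j = n the left-hand side is a^(n+1), which
    bounds a, and then all X_j. *)
Lemma geometric_bounds (R : realType) (n : nat) (X : nat -> R) (K a : R) :
  1 <= K -> 0 < a -> (forall j, (j <= n)%N -> 0 < X j) -> X 0%N = 1 ->
  (forall j, (0 < j <= n)%N ->
     X j * X (n.+1 - j)%N <= K /\ 1 <= K * (X j * X (n.+1 - j)%N)) ->
  (forall j, (j <= n)%N ->
     X j * X (n - j)%N <= K * a /\ a <= K * (X j * X (n - j)%N)) ->
  X n = a ->
  forall j, (j <= n)%N -> X j <= K ^+ (4 * n) /\ 1 <= K ^+ (4 * n) * X j.
Proof.
move=> K1 a0 X0 X00 Hpair Hflux Xn.
have K0 : 0 < K by apply: lt_le_trans K1.
have step j : (j < n)%N -> X j.+1 * a <= K ^+ 2 * X j /\ X j <= K ^+ 2 * (X j.+1 * a).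
  move=> jn; have [f1 f2] := Hflux j (ltnW jn).
  have [g1 g2] := Hpair j.+1 jn; rewrite subSS in g1 g2.
  have := X0 j.+1 jn; have := X0 j (ltnW jn); have := X0 _ (leq_subr j n).
  move: (X j) (X j.+1) (X (n - j)%N) f1 f2 g1 g2 => u v w f1 f2 g1 g2 w0 u0 v0.
  split.
    apply: le_trans (_ : v * (K * (u * w)) <= _); first by rewrite ler_pM2l.
    rewrite (_ : v * _ = K * u * (v * w)); last ring.
    rewrite (_ : K ^+ 2 * u = K * u * K); last ring.
    by rewrite ler_pM2l // mulr_gt0.
  apply: le_trans (_ : u * (K * (v * w)) <= _); first by rewrite ler_pMr.
  rewrite (_ : u * _ = K * v * (u * w)); last ring.
  rewrite (_ : K ^+ 2 * _ = K * v * (K * a)); last ring.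
  by rewrite ler_pM2l // mulr_gt0.
have geo j : (j <= n)%N ->
    X j * a ^+ j <= K ^+ (2 * j) /\ 1 <= K ^+ (2 * j) * (X j * a ^+ j).
  elim: j => [|j IH] jn; first by rewrite X00 muln0 !expr0 !mul1r.
  have [i1 i2] := IH (ltnW jn); have [s1 s2] := step j jn.
  have aj : 0 < a ^+ j by rewrite exprn_gt0.
  have Kj : 0 < K ^+ (2 * j) by rewrite exprn_gt0.
  have -> : K ^+ (2 * j.+1) = K ^+ 2 * K ^+ (2 * j) by rewrite -exprD mulnS.
  rewrite exprS; split.
    apply: le_trans (_ : K ^+ 2 * X j * a ^+ j <= _).
      by rewrite mulrA ler_pM2r.
    by rewrite -mulrA ler_pM2l // exprn_gt0.
  apply: le_trans i2 _.
  rewrite (_ : K ^+ 2 * _ * _ = K ^+ (2 * j) * (K ^+ 2 * (X j.+1 * a) * a ^+ j));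
    last ring.
  by rewrite ler_pM2l // ler_pM2r.
have [g1 g2] := geo n (leqnn n); rewrite Xn -exprS in g1 g2.
have KS m : K ^+ (2 * m) <= (K ^+ 2) ^+ m.+1.
  by rewrite -exprM; apply: ler_weXn2l => //; rewrite leq_mul2l leqnSn orbT.
have aK : a <= K ^+ 2.
  rewrite -(@ler_pXn2r _ n.+1) // ?nnegrE; first exact: le_trans g1 (KS n).
    exact: ltW.
  by rewrite exprn_ge0 // ltW.
have Ka : 1 <= K ^+ 2 * a.
  rewrite -(@ler_pXn2r _ n.+1) ?nnegrE ?ler01 //;
    last by rewrite mulr_ge0 ?sqr_ge0 // ltW.
  rewrite expr1n exprMn; apply: le_trans g2 _.
  by rewrite ler_pM2r ?exprn_gt0 // KS.
move=> j jn; have [h1 h2] := geo j jn.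
have Xj := X0 j jn.
have Kj : K ^+ (2 * j) * K ^+ (2 * j) <= K ^+ (4 * n).
  by rewrite -exprD; apply: ler_weXn2l => //; lia.
split.
  apply: le_trans (_ : X j * (K ^+ 2 * a) ^+ j <= _).
    by rewrite ler_pMr // exprn_ege1.
  rewrite exprMn -exprM mulrCA; apply: le_trans Kj.
  by rewrite ler_pM2l // exprn_gt0.
apply: le_trans h2 _.
apply: le_trans (_ : K ^+ (2 * j) * K ^+ (2 * j) * X j <= _); last by rewrite ler_pM2r.
rewrite -mulrA ler_pM2l ?exprn_gt0 // mulrC ler_pM2r // exprM.
case: (posnP j) => [->|j0]; first by rewrite !expr0.
by rewrite ler_pXn2r // nnegrE ?exprn_ge0 // ltW.
Qed.

Lemma reciprocal_bounds (R : realType) (c C K s u v : R) :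
  0 < u -> 0 < v -> 0 < K -> c * v <= s -> s <= C * v -> u * s = 1 ->
  1 <= K * c -> C <= K -> u * v <= K /\ 1 <= K * (u * v).
Proof.
move=> u0 v0 K0 s1 s2 us Kc KC; have uv : 0 < u * v by rewrite mulr_gt0.
split.
  apply: le_trans (_ : K * c * (u * v) <= _); first by rewrite ler_pMl.
  rewrite (_ : _ * _ = K * (u * (c * v))); last ring.
  by rewrite -[leRHS]mulr1 ler_pM2l // -us ler_pM2l.
rewrite -us; apply: le_trans (_ : u * (C * v) <= _); first by rewrite ler_pM2l.
by rewrite mulrCA ler_pM2r.
Qed.

Lemma eqn_sub_compl (q i j : nat) : (i <= q)%N -> (j == q - i)%N = (i + j == q)%N.
Proof. by lia. Qed.

Lemma compl_level (q i : nat) : (0 < i <= q)%N -> (0 < q.+1 - i <= q)%N.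
Proof. by lia. Qed.

Section Balance.
Variables (R : realType) (n p N : nat) (b : 'I_p.+1 -> nat).
Variable S : 'I_p.+1 -> 'I_p.+1 -> R.
Hypothesis st : staircase n b S.
Hypothesis N_gt0 : (0 < N)%N.
Hypothesis card_level : forall j, (0 < j <= n)%N -> #|[pred k | b k == j]| = N.

Let level_flux x j := \sum_(k | b k == j) flux n b S x k.

Let level_flux_gt0 x j : (forall k, 0 < x k) -> (j <= n)%N -> 0 < level_flux x j.
Proof.
move=> x0 jn; have [k bk] := stair_onto st jn;
  have [l bl] := stair_onto st (leq_subr j n).
have e : (b k + b l == n)%N by rewrite bk bl subnKC.
rewrite /level_flux (bigD1 k) ?bk //= ltr_pwDl //.
  rewrite /flux mulr_gt0 // (bigD1 l) //= ltr_pwDl //.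
    by rewrite mulr_gt0 // (stair_pos st) // e.
  apply: sumr_ge0 => i /andP[ei _]; rewrite mulr_ge0 // ltW //.
  by rewrite (stair_pos st) // ei.
apply: sumr_ge0 => i _; rewrite /flux mulr_ge0 //; first exact: ltW.
apply: sumr_ge0 => l' el; rewrite mulr_ge0 // ltW //.
by rewrite (stair_pos st) // el.
Qed.

Let level_fluxE x j : (j <= n)%N -> level_flux x j =
  \sum_(k | b k == j) \sum_(l | b l == (n - j)%N) S k l * (x k * x l).
Proof.
move=> jn; apply: eq_bigr => k /eqP bk; rewrite /flux mulr_sumr.
apply: eq_big => [l|l _]; last ring.
by rewrite bk; apply/eqP/eqP; lia.
Qed.

Let level_flux_sym x j : (j <= n)%N -> level_flux x (n - j)%N = level_flux x j.
Proof.
move=> jn; rewrite !level_fluxE ?leq_subr // subKn // exchange_big /=.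
by apply: eq_bigr => k _; apply: eq_bigr => l _; rewrite (stair_sym st); ring.
Qed.

(** Multiplying level j by t_j preserves the leading equations if t_j t_(n+1-j)
    = 1 and turns the flux al_j of level j into t_j t_(n-j) al_j = t_j al_j /
    t_(j+1). It is constant, equal to a, for t_j = prod_(i < j) al_i / a; the
    end condition t_(n+1) = 1 determines a as a geometric mean, and the symmetry
    al_j = al_(n-j) gives the pairing condition. *)
Lemma balanced_profile : exists x a, [/\ forall k, 0 < x k, x ord0 = 1,
  forall k, k != ord0 ->
    x k * (\sum_(l | (b k + b l == n.+1)%N) S k l * x l) = 1 &
  forall j, (j <= n)%N -> level_flux x j = a].
Proof.
have [x [x0 xo xl]] := sinkhorn st N_gt0 card_level.
pose al j := level_flux x j.
have al0 j : (j <= n)%N -> 0 < al j by exact: level_flux_gt0.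
have prod0 : 0 < \prod_(i < n.+1) al i.
  by apply: prodr_gt0 => i _; apply: al0; rewrite -ltnS.
have [a a0 aE] := root_exists n prod0.
pose t j := \prod_(i < j) (al i / a).
have tS j : t j.+1 = t j * (al j / a) by rewrite /t big_ord_recr.
have t0 j : (j <= n.+1)%N -> 0 < t j.
  move=> jn; apply: prodr_gt0 => i _; rewrite divr_gt0 // al0 //.
  by rewrite -ltnS; apply: leq_trans jn.
have tlast : t n.+1 = 1.
  have := prodr_const 'I_n.+1 a; rewrite card_ord aE => e.
  by rewrite /t prodf_div e divff // gt_eqF.
have tpair j : (j <= n.+1)%N -> t j * t (n.+1 - j)%N = 1.
  elim: j => [|j IH] jn; first by rewrite subn0 tlast mulr1 /t big_ord0.
  rewrite -(IH (ltnW jn)) subSS subSn // !tS /al level_flux_sym //; ring.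
exists (fun k => t (b k) * x k), a; split.
- by move=> k; rewrite mulr_gt0 // t0 // ltnW // ltnS (level_le st).
- by rewrite (stair_root st) xo mulr1 /t big_ord0.
- move=> k k0; rewrite -(xl k k0) !mulr_sumr; apply: eq_bigr => l /eqP e.
  have bl : b l = (n.+1 - b k)%N by lia.
  have := tpair (b k) (leqW (level_le st k)); rewrite -bl => e1.
  transitivity (t (b k) * t (b l) * (x k * (S k l * x l))); first by ring.
  by rewrite e1 mul1r.
move=> j jn; rewrite level_fluxE //.
transitivity (t j * t (n - j)%N * al j).
  rewrite /al level_fluxE // mulr_sumr; apply: eq_bigr => k /eqP bk.
  by rewrite mulr_sumr; apply: eq_bigr => l /eqP bl; rewrite bk bl; ring.
have := tpair j.+1 jn; rewrite subSS tS => e.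
rewrite -[RHS]mulr1 -e; field; rewrite gt_eqF //.
Qed.

Variables c C : R.
Hypotheses (c_gt0 : 0 < c) (C_gt0 : 0 < C).
Hypothesis S_bounds : forall k l, k != ord0 -> l != ord0 ->
  (b k + b l == n)%N || (b k + b l == n.+1)%N -> c / N%:R < S k l < C / N%:R.
Hypothesis S_root : forall k, k != ord0 -> S k ord0 = 1.

(** A number that dominates 1, c, C and their inverses at once. *)
Definition entry_ratio : R := 1 + c + C + c^-1 + C^-1.

(** Replacing the entries of S by c/N or C/N in the leading equations and in the
    flux condition gives the hypotheses of [geometric_bounds] for the block
    means X. *)
Lemma profile_bounds x a : (forall k, 0 < x k) -> x ord0 = 1 ->
  (forall k, k != ord0 ->
    x k * (\sum_(l | (b k + b l == n.+1)%N) S k l * x l) = 1) ->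
  (forall j, (j <= n)%N -> level_flux x j = a) ->
  forall k, k != ord0 -> x k <= entry_ratio ^+ (4 * n).+1 /\
                         1 <= entry_ratio ^+ (4 * n).+1 * x k.
Proof.
move=> x0 xo xlead xflux; set K := entry_ratio.
have cV0 : 0 < c^-1 by rewrite invr_gt0.
have CV0 : 0 < C^-1 by rewrite invr_gt0.
have KE : [/\ 1 <= K, C <= K & c^-1 <= K].
  rewrite /K /entry_ratio; move: (c^-1) (C^-1) cV0 CV0 c_gt0 C_gt0 => u v ? ? ? ?.
  by split; lra.
have [K1 KC cVK] := KE.
have K0 : 0 < K by apply: lt_le_trans K1.
have Kc : 1 <= K * c.
  by rewrite -(mulVf (lt0r_neq0 c_gt0)) ler_pM2r.
have N0 : 0 < N%:R :> R by rewrite ltr0n.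
pose X j : R := if j == 0%N then 1 else (\sum_(k | b k == j) x k) / N%:R.
have X0 j : (j <= n)%N -> 0 < X j.
  rewrite /X; case: eqVneq => // j0 jn; rewrite divr_gt0 //.
  have [k bk] := stair_onto st jn; rewrite (bigD1 k) ?bk //= ltr_pwDl //.
  by apply: sumr_ge0 => i _; exact: ltW.
have notroot k j : (0 < j)%N -> b k = j -> k != ord0.
  by move=> j0 bk; rewrite -(level0 st) bk -lt0n.
have sums k j : k != ord0 -> (0 < j)%N -> (b k + j == n)%N || (b k + j == n.+1)%N ->
    c * X j <= \sum_(l | b l == j) S k l * x l <= C * X j.
  move=> k0 j0 e; rewrite /X gtn_eqF //.
  rewrite !mulrA !(mulrAC _ _ (N%:R^-1)) !mulr_sumr; apply/andP; split.
    apply: ler_sum => l /eqP bl; rewrite ler_pM2r //.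
    have /andP[/ltW h _] := S_bounds k0 (notroot l j j0 bl) (ltac:(by rewrite bl)).
    exact: h.
  apply: ler_sum => l /eqP bl; rewrite ler_pM2r //.
  have /andP[_ /ltW h] := S_bounds k0 (notroot l j j0 bl) (ltac:(by rewrite bl)).
  exact: h.
have pairs k : k != ord0 ->
    x k * X (n.+1 - b k)%N <= K /\ 1 <= K * (x k * X (n.+1 - b k)%N).
  move=> k0; have bk := stair_level st k0.
  have /andP[j0 jn] := compl_level bk.
  have bkn : (b k <= n.+1)%N by apply: leqW (level_le st k).
  have e : (b k + (n.+1 - b k) == n)%N || (b k + (n.+1 - b k) == n.+1)%N.
    by rewrite subnKC // eqxx orbT.
  have /andP[s1 s2] := sums k _ k0 j0 e.
  have E : \sum_(l | b l == (n.+1 - b k)%N) S k l * x l =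
      \sum_(l | (b k + b l == n.+1)%N) S k l * x l.
    by apply: eq_bigl => l; rewrite eqn_sub_compl.
  have Xp : 0 < X (n.+1 - b k)%N by apply: X0.
  apply: reciprocal_bounds (x0 k) Xp K0 s1 s2 _ Kc KC.
  by rewrite E xlead.
have mean j (f : R) (P : 'I_p.+1 -> R) : (0 < j <= n)%N ->
    (forall k, b k = j -> P k <= f) -> \sum_(k | b k == j) P k <= N%:R * f.
  move=> jI Pf; apply: le_trans (_ : \sum_(k | b k == j) f <= _).
    by apply: ler_sum => k /eqP; exact: Pf.
  by rewrite sumr_const card_level // mulr_natl.
pose al := a / N%:R.
have sumX j : (0 < j)%N -> \sum_(k | b k == j) x k = N%:R * X j.
  by move=> j0; rewrite /X gtn_eqF // mulrC divfK ?gt_eqF.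
have Xpair j : (0 < j <= n)%N ->
    X j * X (n.+1 - j)%N <= K /\ 1 <= K * (X j * X (n.+1 - j)%N).
  move=> jI; have /andP[j0 jn] := jI; split.
    rewrite -(ler_pM2l N0) mulrA -sumX // mulr_suml.
    by apply: mean => // k bk; have [] := pairs k (notroot k j j0 bk); rewrite bk.
  rewrite -(ler_pM2l N0) mulr1 !mulrA (mulrC _ K) -(mulrA K) -sumX //.
  rewrite -mulrA mulr_suml mulr_sumr.
  have := @mean j (-1) (fun k => - (K * (x k * X (n.+1 - j)%N))) jI.
  rewrite sumrN mulrN1 lerN2; apply=> k bk; rewrite lerN2.
  by have [_] := pairs k (notroot k j j0 bk); rewrite bk.
have al_last : al = X n.
  have n0 := stair_n_gt0 st.
  apply: (mulfI (lt0r_neq0 N0)); rewrite -sumX // mulrC divfK ?gt_eqF //.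
  rewrite -(xflux 0%N) // /level_flux (eq_bigl (pred1 ord0)); last by move=> k;
    rewrite (level0 st).
  rewrite big_pred1_eq /flux xo mul1r (stair_root st); apply: eq_bigr => l /eqP bl.
  by rewrite (stair_sym st) S_root ?mul1r //; apply: notroot n0 bl.
have Xflux j : (j <= n)%N ->
    X j * X (n - j)%N <= K * al /\ al <= K * (X j * X (n - j)%N).
  move=> jn; have alp : 0 < al by rewrite al_last X0.
  have endpoint : al <= K * al by rewrite ler_pMl.
  have [->|j0] := posnP j; first by rewrite subn0 {1 3}/X /= !mul1r -al_last.
  have [->|jn'] := eqVneq j n.
    by rewrite subnn {2 4}/X /= !mulr1 -al_last.
  have nj0 : (0 < n - j)%N by rewrite subn_gt0 ltn_neqAle jn' jn.
  have XX : 0 < X j * X (n - j)%N by rewrite mulr_gt0 // X0 // leq_subr.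
  have fl : level_flux x j =
    \sum_(k | b k == j) x k * \sum_(l | b l == (n - j)%N) S k l * x l.
    apply: eq_bigr => k /eqP bk; congr (_ * _); apply: eq_bigl => l.
    by rewrite bk eqn_sub_compl.
  have alE : N%:R * al = level_flux x j by rewrite xflux // mulrC divfK ?gt_eqF.
  have bnd k : b k == j -> c * X (n - j)%N <=
    \sum_(l | b l == (n - j)%N) S k l * x l <= C * X (n - j)%N.
    move=> /eqP bk; apply: sums => //; first exact: notroot bk.
    by rewrite bk subnKC // eqxx.
  have lo : c * (X j * X (n - j)%N) <= al.
    rewrite -(ler_pM2l N0) alE fl (_ : N%:R * _ =
      N%:R * X j * (c * X (n - j)%N)); last ring.
    rewrite -sumX // mulr_suml; apply: ler_sum => k bk.
    by rewrite ler_pM2l //; case/andP: (bnd k bk).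
  have hi : al <= C * (X j * X (n - j)%N).
    rewrite -(ler_pM2l N0) alE fl (_ : N%:R * (C * _) =
      N%:R * X j * (C * X (n - j)%N)); last ring.
    rewrite -sumX // mulr_suml; apply: ler_sum => k bk.
    by rewrite ler_pM2l //; case/andP: (bnd k bk).
  split; last by apply: le_trans hi _; rewrite ler_pM2r.
  apply: le_trans (_ : K * (c * (X j * X (n - j)%N)) <= _); last by rewrite ler_pM2l.
  by rewrite mulrA ler_pMl.
have al0 : 0 < al by rewrite al_last X0.
have X00 : X 0%N = 1 by [].
have geo := geometric_bounds K1 al0 X0 X00 Xpair Xflux (esym al_last).
move=> k k0; have [p1 p2] := pairs k k0; have bk := stair_level st k0.
have /andP[_ jn] := compl_level bk.
have [g1 g2] := geo _ jn; rewrite exprS; split.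
  apply: le_trans (_ : x k * (K ^+ (4 * n) * X (n.+1 - b k)%N) <= _);
    first by rewrite ler_pMr.
  by rewrite mulrCA mulrC ler_pM2r // exprn_gt0.
apply: le_trans p2 _; rewrite -mulrA ler_pM2l // mulrC.
by rewrite ler_pM2r.
Qed.

End Balance.

(** * Uniqueness of the solution in the upper half-plane *)

Section Uniqueness.
Variables (R : realType) (d : nat) (S : 'I_d -> 'I_d -> R) (z : R[i]).
Hypothesis S_ge0 : forall k l, 0 <= S k l.
Hypothesis z_uhp : 0 < complex.Im z.

Definition solves_at (m : 'I_d -> R[i]) : Prop :=
  (forall k, 0 < complex.Im (m k)) /\
  (forall k, - (1 / m k) = z + \sum_l (S k l)%:C * m l).

Lemma uhp_neq0 (w : R[i]) : 0 < complex.Im w -> w != 0.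
Proof. by apply: contraTneq => ->; rewrite ltxx. Qed.

(** Imaginary part of the equation; the strict inequality is the contribution of
    Im z > 0. *)
Lemma solves_Im m k : solves_at m ->
  \sum_l S k l * complex.Im (m l) < complex.Im (m k) / normc (m k) ^+ 2.
Proof.
move=> [m0 /(_ k)/(congr1 (@complex.Im R))].
have -> : complex.Im (- (1 / m k)) = complex.Im (m k) / normc (m k) ^+ 2.
  by rewrite -nsqE mul1r /nsq; case: (m k) => x y /=; rewrite opprK.
have ImD (u w : R[i]) : complex.Im (u + w) = complex.Im u + complex.Im w.
  by case: u w => [? ?] [].
rewrite ImD Im_sum => ->.
rewrite [X in _ < _ + X](eq_bigr (fun l => S k l * complex.Im (m l))) ?ltrDr //.
by move=> l _; case: (m l) => x y /=; rewrite mul0r addr0.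
Qed.

(** The difference of two solutions satisfies m - m' = m m' S (m - m'). Measured
    relatively to sqrt(Im m Im m'), this linear map is a strict contraction in
    the maximum norm: by the inequality between arithmetic and geometric means
    and [solves_Im], S sqrt(Im m Im m') < sqrt(Im m Im m') / |m m'|. *)
Lemma solves_at_unique m m' : solves_at m -> solves_at m' -> m =1 m'.
Proof.
move=> sm sm'; have [m0 meq] := sm; have [m0' meq'] := sm'.
pose e k := normc (m k - m' k) / (Num.sqrt (complex.Im (m k)) * Num.sqrt
  (complex.Im (m' k))).
have sq0 k : 0 < Num.sqrt (complex.Im (m k)) by rewrite sqrtr_gt0.
have sq0' k : 0 < Num.sqrt (complex.Im (m' k)) by rewrite sqrtr_gt0.
move=> k; apply/eqP; rewrite -subr_eq0 -normc_eq0.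
have [k0 _ emax] := @arg_maxP _ _ _ k xpredT e isT.
suff e0 : e k0 <= 0.
  rewrite eq_le normc_ge0 andbT; have := le_trans (emax k isT) e0.
  by rewrite /e ler_pdivrMr ?mulr_gt0 // mul0r.
rewrite leNgt; apply/negP => D0; set D := e k0 in D0 emax.
have DE : normc (m k0 - m' k0) =
    D * (Num.sqrt (complex.Im (m k0)) * Num.sqrt (complex.Im (m' k0))).
  by rewrite /D /e divfK // gt_eqF // mulr_gt0.
have mn0 := uhp_neq0 (m0 k0); have mn0' := uhp_neq0 (m0' k0).
have n0 : 0 < normc (m k0) by rewrite normc_gt0.
have n0' : 0 < normc (m' k0) by rewrite normc_gt0.
have diff : m k0 - m' k0 = m k0 * m' k0 * \sum_l (S k0 l)%:C * (m l - m' l).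
  have : - (1 / m k0) - - (1 / m' k0) = \sum_l (S k0 l)%:C * (m l - m' l).
    rewrite meq meq' opprD addrACA subrr add0r -sumrB.
    by apply: eq_bigr => l _; rewrite mulrBr.
  by move=> <-; field; rewrite mn0 mn0'.
(* this weight turns the arithmetic-geometric bound into an equality at k0 *)
pose t := Num.sqrt (complex.Im (m' k0)) * normc (m k0) /
          (Num.sqrt (complex.Im (m k0)) * normc (m' k0)).
have t0 : 0 < t by rewrite divr_gt0 // mulr_gt0.
have amgm (u v : R) : 0 < u -> 0 < v -> Num.sqrt u * Num.sqrt v <= (t * u + v / t) / 2.
  move=> u0 v0; have := sqr_ge0 (t * Num.sqrt u - Num.sqrt v).
  rewrite sqrrB exprMn (sqr_sqrtr (ltW u0)) (sqr_sqrtr (ltW v0)) => h.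
  suff : 0 <= t * (t * u + v / t - 2 * (Num.sqrt u * Num.sqrt v)).
    by rewrite pmulr_rge0 //; lra.
  apply: le_trans h _; rewrite le_eqVlt; apply/orP; left; apply/eqP.
  by field; rewrite gt_eqF.
have bound : normc (m k0 - m' k0) <= normc (m k0) * normc (m' k0) *
   (D * ((t * (\sum_l S k0 l * complex.Im (m l)) +
         (\sum_l S k0 l * complex.Im (m' l)) / t) / 2)).
  rewrite diff normcM normcM; apply: ler_wpM2l; first by rewrite mulr_ge0 ?normc_ge0.
  apply: le_trans (normc_sum _ _ _) _.
  rewrite mulr_sumr mulr_suml -big_split mulr_suml mulr_sumr.
  apply: ler_sum => l _ /=; rewrite normcM normcC ger0_norm //.
  rewrite (_ : D * _ = S k0 l * (D * ((t * complex.Im (m l) + complex.Im (m' l)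
    / t) / 2))); last ring.
  apply: ler_wpM2l => //; apply: le_trans (ler_wpM2l (ltW D0) (amgm _ _ (m0 l) (m0' l))).
  by rewrite -ler_pdivrMr ?mulr_gt0 //; exact: emax.
have h1 := solves_Im k0 sm; have h2 := solves_Im k0 sm'.
have : normc (m k0 - m' k0) < normc (m k0) * normc (m' k0) *
   (D * ((t * (complex.Im (m k0) / normc (m k0) ^+ 2) +
         (complex.Im (m' k0) / normc (m' k0) ^+ 2) / t) / 2)).
  apply: le_lt_trans bound _; rewrite ltr_pM2l ?mulr_gt0 // ltr_pM2l //.
  by rewrite ltr_pM2r ?invr_gt0 // ltrD // ?ltr_pM2l // ltr_pM2r // invr_gt0.
rewrite DE -{2}(sqr_sqrtr (ltW (m0 k0))) -{2}(sqr_sqrtr (ltW (m0' k0))) /t.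
have := sq0 k0; have := sq0' k0; move: (Num.sqrt _) (Num.sqrt _) => u v u0 v0.
rewrite (_ : normc (m k0) * _ * _ = D * (u * v)) ?ltxx //.
by field; rewrite !gt_eqF.
Qed.

End Uniqueness.

(** * Polar form and arguments *)

Section Polar.
Variable R : realType.
Implicit Types (z w : R[i]) (t u : R).

Definition cis t : R[i] := cos t +i* sin t.

Lemma cisD t u : cis (t + u) = cis t * cis u.
Proof. by rewrite /cis cosD sinD; congr (_ +i* _); rewrite addrC [X in X + _]mulrC. Qed.

Lemma normc_cis t : normc (cis t) = 1.
Proof. by rewrite /= cos2Dsin2 sqrtr1. Qed.

Lemma cisX t k : cis t ^+ k = cis (k%:R * t).
Proof.
elim: k => [|k IH]; first by rewrite expr0 mul0r /cis cos0 sin0.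
by rewrite exprS IH -cisD -{1}(mul1r t) -mulrDl -natr1 addrC.
Qed.

Section UpperPoint.
Variable w : R[i].
Hypothesis w_uhp : 0 < complex.Im w.

Let r_gt0 : 0 < normc w.
Proof. by rewrite normc_gt0; apply: contraTneq w_uhp => ->; rewrite ltxx. Qed.

Let cosine_lt1 : -1 < complex.Re w / normc w < 1.
Proof.
rewrite ltr_pdivrMr // ltr_pdivlMr // mul1r mulN1r -ltr_norml.
case: w w_uhp => x y /= y0; rewrite -sqrtr_sqr ltr_sqrt ?ltrDl ?exprn_gt0 //.
by rewrite ltr_wpDl ?sqr_ge0 ?exprn_gt0.
Qed.

Lemma cargE : carg w = acos (complex.Re w / normc w).
Proof. by rewrite /carg ltW. Qed.

Lemma carg_bounds : 0 < carg w < pi.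
Proof.
have /andP[h1 h2] := cosine_lt1.
by rewrite cargE acos_gt0 ?acos_ltpi ?h1 ?h2 //= ltW.
Qed.

Lemma polar : w = (normc w)%:C * cis (carg w).
Proof.
have /andP[h1 h2] := cosine_lt1.
have hI : -1 <= complex.Re w / normc w <= 1 by rewrite !ltW.
rewrite cargE /cis sin_acos // acosK ?in_itv //=.
have -> : Num.sqrt (1 - (complex.Re w / normc w) ^+ 2) = complex.Im w / normc w.
  rewrite -[RHS]ger0_norm ?divr_ge0 ?normc_ge0 ?ltW // -sqrtr_sqr; congr Num.sqrt.
  have n0 : nsq w != 0 by rewrite nsqE expf_neq0 // gt_eqF.
  rewrite !expr_div_n -nsqE -(divff n0) -mulrBl; congr (_ / _).
  by rewrite {1}/nsq addrC addKr.
apply/eqP; rewrite eq_complex /= !mul0r subr0 addr0 !(mulrC (normc w)).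
have rn := lt0r_neq0 r_gt0; by rewrite !divfK // !eqxx.
Qed.

Lemma cpowD a b : cpow w (a + b) = cpow w a * cpow w b.
Proof.
rewrite /cpow powRD; last by rewrite implybE (gt_eqF r_gt0) orbT.
by rewrite -/(cis _) mulrDl cisD rmorphM /=; rewrite -!/(cis _); ring.
Qed.

Lemma cpow0 : cpow w 0 = 1.
Proof. by rewrite /cpow powRr0 mul0r cos0 sin0 mul1r. Qed.

Lemma cpow1 : cpow w 1 = w.
Proof. by rewrite /cpow powRr1 ?normc_ge0 // mul1r -/(cis _) -polar. Qed.

Lemma cpowX a k : cpow w a ^+ k = cpow w (k%:R * a).
Proof.
elim: k => [|k IH]; first by rewrite expr0 mul0r cpow0.
by rewrite exprS IH -cpowD -{1}(mul1r a) -mulrDl -natr1 addrC.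
Qed.

Lemma normc_cpow a : normc (cpow w a) = normc w `^ a.
Proof. by rewrite /cpow normcM -/(cis _) normc_cis mulr1 normcC ger0_norm ?powR_ge0. Qed.

End UpperPoint.

(** On the upper half-plane the argument is the arc cosine of Re w / |w|, which
    is continuous there, and this quotient is 4 rho close to cos t. *)
Lemma carg_near t e : 0 < t < pi -> 0 < e ->
  exists2 rho : R, 0 < rho & forall (x0 : R) (x : R[i]), 0 < x0 ->
    normc (x - x0%:C) <= rho * x0 ->
    0 < complex.Im (cis t * x) /\ `|carg (cis t * x) - t| < e.
Proof.
move=> tI e0; have sin0 := sin_gt0_pi tI; have /andP[t0 tpi] := tI.
have tI' : t \in `[0, pi] by rewrite in_itv /= !ltW.
have cosI : -1 < cos t < 1.
  have zI : (0 : R) \in `[0, pi] by rewrite in_itv /= lexx pi_ge0.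
  have pI : (pi : R) \in `[0, pi] by rewrite in_itv /= lexx pi_ge0.
  by rewrite -cospi -[X in _ < _ < X](@cos0 R) !ltr_cos // t0 tpi.
have /cvgrPdist_lt/(_ e e0)/nbhs_ballP[eta /= eta0 near] := continuous_acos cosI.
exists (Num.min (1 / 2) (Num.min (sin t / 2) (eta / 8))).
  by rewrite !lt_min !divr_gt0.
move=> x0 x x00; set rho := Num.min _ _ => hx.
have rho1 : rho <= 1 / 2 by rewrite ge_min lexx.
have rho2 : rho <= sin t / 2 by rewrite ge_min [X in _ || X]ge_min lexx orbT.
have rho3 : rho <= eta / 8 by rewrite ge_min [X in _ || X]ge_min lexx !orbT.
clearbody rho.
pose E := cis t * (x - x0%:C).
have hE : normc E <= rho * x0 by rewrite /E normcM normc_cis mul1r.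
have wE : cis t * x = (x0 * cos t + complex.Re E) +i* (x0 * sin t + complex.Im E).
  rewrite (_ : cis t * x = x0%:C * cis t + E); last by rewrite /E; ring.
  by case: (E) => u v; rewrite /cis /=; simpc.
have := normc_Re E; have := normc_Im E; rewrite !ler_norml => /andP[i1 i2] /andP[q1 q2].
have w_uhp : 0 < complex.Im (cis t * x).
  rewrite wE /=; have : rho * x0 <= sin t / 2 * x0 by rewrite ler_pM2r.
  by have := mulr_gt0 x00 sin0; lra.
split=> //; set w := cis t * x in w_uhp *.
rewrite (cargE w_uhp) distrC -{1}(cosK tI').
have wn : `|normc w - x0| <= rho * x0.
  have -> : normc w = normc x by rewrite /w normcM normc_cis mul1r.
  have a1 : normc x <= normc (x - x0%:C) + x0.
    by rewrite -{1}(subrK x0%:C x) -[X in _ <= _ + X]gtr0_norm // -normcC le_normcD.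
  have a2 : x0 <= normc (x - x0%:C) + normc x.
    rewrite -normcN -{1}[x0]gtr0_norm // -normcC.
    by rewrite -{1}(subrK x x0%:C) opprB le_normcD.
  by rewrite ler_norml; apply/andP; split; lra.
move: wn; rewrite ler_norml => /andP[n1 n2].
have rx : rho * x0 <= 1 / 2 * x0 by rewrite ler_pM2r.
have n0 : 0 < normc w by lra.
apply: near; rewrite -ball_normE /= distrC ltr_norml.
have e8 : rho * x0 <= eta / 8 * x0 by rewrite ler_pM2r.
have ReE : complex.Re w = x0 * cos t + complex.Re E by rewrite /w wE.
have /andP[cl cr] := cosI.
have : `|complex.Re w - cos t * normc w| <= 2 * (rho * x0).
  have : `|cos t * (x0 - normc w)| <= 1 * (rho * x0).
    rewrite normrM; apply: ler_pM => //; rewrite ler_norml; apply/andP; split; lra.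
  by rewrite !ler_norml ReE mulrBr => /andP[? ?]; apply/andP; split; lra.
rewrite ler_norml => /andP[m1 m2]; apply/andP; split.
  by rewrite ltrBrDr ltr_pdivlMr // mulrDl mulNr; nra.
by rewrite ltrBlDr ltr_pdivrMr // mulrDl; nra.
Qed.

End Polar.

(** * The block matrix as a staircase interaction *)

Section Extension.
Variables (R : realType) (n N : nat) (S : 'M[R]_(n * N)).
Hypothesis N_gt0 : (0 < N)%N.
Hypothesis n_gt0 : (0 < n)%N.

Definition ext_level (i : 'I_(n * N).+1) : nat :=
  if unlift ord0 i is Some k then (k %/ N).+1 else 0%N.

(** The entries 1 in the row and column of ord0 encode the coefficient of z in
    every equation. The corner entry is 0: it belongs to no equation. *)
Definition ext_entry (i j : 'I_(n * N).+1) : R :=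
  match unlift ord0 i, unlift ord0 j with
  | Some k, Some l => S k l
  | None, None => 0
  | _, _ => 1
  end.

Lemma ext_level0 : ext_level ord0 = 0%N.
Proof. by rewrite /ext_level unlift_none. Qed.

Lemma ext_level_lift k : ext_level (lift ord0 k) = (k %/ N).+1.
Proof. by rewrite /ext_level liftK. Qed.

Lemma ext_entry_lift k l : ext_entry (lift ord0 k) (lift ord0 l) = S k l.
Proof. by rewrite /ext_entry !liftK. Qed.

Lemma ext_entry_root k : ext_entry (lift ord0 k) ord0 = 1.
Proof. by rewrite /ext_entry liftK unlift_none. Qed.

Lemma block_of (k : 'I_(n * N)) : (k %/ N < n)%N.
Proof. by rewrite ltn_divLR. Qed.

Lemma entry_block (k l : 'I_(n * N)) : S k l =
  block S (Ordinal (block_of k)) (Ordinal (block_of l))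
    (Ordinal (ltn_pmod k N_gt0)) (Ordinal (ltn_pmod l N_gt0)).
Proof.
by rewrite mxE; congr (S _ _); apply: val_inj; rewrite /= -divn_eq.
Qed.

Lemma card_ext_level j : (0 < j <= n)%N -> #|[pred k | ext_level k == j]| = N.
Proof.
case: j => // j /= jn.
pose f (nu : 'I_N) : 'I_(n * N).+1 := lift ord0 (block_ord (Ordinal jn) nu).
have f_inj : injective f.
  move=> u v /lift_inj/(congr1 val)/= /eqP; rewrite eqn_add2l => /eqP.
  exact: val_inj.
rewrite -[RHS](card_ord N) -(card_codom f_inj); apply: eq_card => i.
rewrite inE; apply/eqP/codomP => [|[nu ->]]; last first.
  by rewrite ext_level_lift /= divnMDl // divn_small ?addn0.
case: (unliftP ord0 i) => [k ->|->]; last by rewrite ext_level0.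
rewrite ext_level_lift => -[kj]; exists (Ordinal (ltn_pmod k N_gt0)).
by congr lift; apply: val_inj; rewrite /= -kj -divn_eq.
Qed.

Hypothesis S_sym : S^T = S.
Hypothesis S_pos : forall j k : 'I_n,
  (j.+1 + k.+1 = n)%N \/ (j.+1 + k.+1 = n + 1)%N -> posmx (block S j k).
Hypothesis S_zero : forall j k : 'I_n,
  (n + 1 < j.+1 + k.+1)%N -> block S j k = 0.

Lemma block_pos (k l : 'I_(n * N)) :
  ((k %/ N).+1 + (l %/ N).+1 == n)%N || ((k %/ N).+1 + (l %/ N).+1 == n.+1)%N ->
  posmx (block S (Ordinal (block_of k)) (Ordinal (block_of l))).
Proof.
move=> e; apply: S_pos; rewrite /= addn1.
by case/orP: e => /eqP; [left|right].
Qed.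

Lemma ext_staircase : staircase n ext_level ext_entry.
Proof.
split => //.
- exact: ext_level0.
- move=> k; case: (unliftP ord0 k) => [i ->|->]; last by rewrite eqxx.
  by rewrite ext_level_lift /= block_of.
- move=> [|j] jn; first by exists ord0; rewrite ext_level0.
  exists (lift ord0 (block_ord (Ordinal jn) (Ordinal N_gt0))).
  by rewrite ext_level_lift /= addn0 mulnK.
- move=> k l; rewrite /ext_entry; case: (unlift ord0 k) (unlift ord0 l) => [i|] [j|] //.
  by rewrite -{1}S_sym mxE.
- move=> k l; case: (unliftP ord0 k) => [i ->|->]; case: (unliftP ord0 l) => [j ->|->].
  + rewrite !ext_level_lift ext_entry_lift entry_block => e; exact: block_pos.
  + by rewrite /ext_entry liftK unlift_none.
  + by rewrite /ext_entry liftK unlift_none.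
  + by rewrite !ext_level0 addn0 (ltn_eqF n_gt0).
move=> k l; case: (unliftP ord0 k) => [i ->|->]; case: (unliftP ord0 l) => [j ->|->].
- rewrite !ext_level_lift ext_entry_lift entry_block => e.
  by rewrite S_zero ?mxE // addn1.
- by rewrite ext_level0 ext_level_lift => e; have := block_of i; lia.
- by rewrite ext_level0 ext_level_lift => e; have := block_of j; lia.
by rewrite !ext_level0.
Qed.

End Extension.

Lemma ceilidxE (R : realType) (n N : nat) (k : 'I_(n * N)) : (0 < N)%N ->
  ceilidx R k = (k %/ N).+1%:R.
Proof.
move=> N0; rewrite /ceilidx; suff -> : Num.ceil (k.+1%:R / N%:R : R) = (k %/ N).+1 by [].
have N0' : 0 < N%:R :> R by rewrite ltr0n.
apply: Num.Theory.ceil_def; apply/andP; split.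
  rewrite -natz -addn1 natrD addrK ltr_pdivlMr // natz -natrM ltr_nat.
  exact: leq_divM.
by rewrite ler_pdivrMr // -natrM ler_nat ltn_ceil.
Qed.

(** * The small parameter attached to a point of the upper half-plane *)

Section SmallParameter.
Variables (R : realType) (n : nat).
Implicit Types z : R[i].

(** The parameter delta, written with the branch of the powers of z so that its
    argument is (2 arg z - pi)/(n+1). *)
Definition small z : R[i] := cpow z (2 / n.+1%:R) * cis (- (pi / n.+1%:R)).

(** The factor z delta^(-j), written so that modulus and argument are visible;
    see [size_at_small]. *)
Definition size_at z (j : nat) : R[i] :=
  cpow z (1 - 2 / n.+1%:R * j%:R) * cis (pi / n.+1%:R * j%:R).

Lemma normc_small z : 0 < complex.Im z -> normc (small z) = normc z `^ (2 / n.+1%:R).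
Proof. by move=> z0; rewrite normcM normc_cpow // normc_cis mulr1. Qed.

Lemma size_at_small z j : 0 < complex.Im z -> size_at z j * small z ^+ j = z.
Proof.
move=> z0; rewrite /size_at /small exprMn cpowX // cisX mulrACA -cpowD // -cisD.
rewrite mulrN (mulrC (pi / _)) subrr (mulrC j%:R) subrK cpow1 //.
by rewrite /cis cos0 sin0 mulr1.
Qed.

Lemma small_last z : 0 < complex.Im z -> small z ^+ n.+1 = - z ^+ 2.
Proof.
move=> z0; rewrite /small exprMn cpowX // cisX mulrN !(mulrC n.+1%:R) !divfK
  ?pnatr_eq0 //.
rewrite (_ : 2 = 1 + 1) // cpowD // cpow1 // -expr2 /cis cosN sinN cospi sinpi.
by rewrite oppr0 [_ +i* _](_ : _ = -1) ?mulrN1 //; apply/eqP;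
  rewrite eq_complex /= oppr0 !eqxx.
Qed.

Lemma cos_third_gt0 : 0 < cos (pi / 3 : R).
Proof. by apply: cos_gt0_pihalf; have := pi_gt0 R; lra. Qed.

(** The angle (2 arg z - pi)/(n+1) is at most pi/3 in absolute value once n >=
    2. *)
Lemma small_sector z : 0 < complex.Im z -> (1 < n)%N ->
  cos (pi / 3) * normc (small z) <= complex.Re (small z).
Proof.
move=> z0 n1; rewrite normc_small // /small /cpow -/(cis _) -mulrA -cisD Re_mulC.
rewrite mulrC [complex.Re _]/=; apply: ler_wpM2l; first exact: powR_ge0.
have /andP[t0 tpi] := carg_bounds z0; set t := carg z in t0 tpi *.
have q0 : 0 < n.+1%:R :> R by rewrite ltr0n.
have q3 : 3 <= n.+1%:R :> R by rewrite ler_nat.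
have -> : 2 / n.+1%:R * t + - (pi / n.+1%:R) = (2 * t - pi) / n.+1%:R by field;
  rewrite gt_eqF.
set u := (2 * t - pi) / _; have uI : `|u| <= pi / 3.
  rewrite /u normf_div normr_nat ler_pdivrMr //.
  apply: le_trans (_ : pi <= _).
    by rewrite ler_norml; apply/andP; split; lra.
  by rewrite mulrAC ler_pdivlMr // ler_pM2l // pi_gt0.
have -> : cos u = cos `|u| by case: (ger0P u) => // _; rewrite cosN.
have p0 := pi_gt0 R.
have uP : `|u| \in `[0, pi] by rewrite in_itv /= normr_ge0 /=; lra.
have tP : pi / 3 \in `[0, (pi : R)] by rewrite in_itv /=; apply/andP; split; lra.
by rewrite leNgt ltr_cos // -leNgt.
Qed.

Lemma small_lt z r0 : 0 < complex.Im z -> 0 < r0 ->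
  normc z < r0 `^ (n.+1%:R / 2) -> 0 < normc (small z) < r0.
Proof.
move=> z0 r00 zr; have zn : 0 < normc z by rewrite normc_gt0 uhp_neq0.
rewrite normc_small // powR_gt0 //=.
have e : r0 = (r0 `^ (n.+1%:R / 2)) `^ (2 / n.+1%:R).
  rewrite -powRrM (_ : _ / 2 * _ = 1) ?powRr1 ?ltW //.
  by field; rewrite -(natrD _ 1) pnatr_eq0.
rewrite [ltRHS]e; apply: gt0_ltr_powR; rewrite ?nnegrE ?powR_ge0 ?normc_ge0 //.
Qed.

Lemma size_at_angle j : (0 < j <= n)%N -> 0 < (pi : R) / n.+1%:R * j%:R < pi.
Proof.
move=> /andP[j0 jn]; have p0 := pi_gt0 R.
rewrite mulr_gt0 ?divr_gt0 ?ltr0n //= mulrAC ltr_pdivrMr ?ltr0n //.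
by rewrite ltr_pM2l // ltr_nat.
Qed.

End SmallParameter.

Section Asymptotics.
Variables (R : realType) (n N : nat) (S : 'M[R]_(n * N)).
Hypothesis st : staircase n (@ext_level n N) (ext_entry S).

Let b := @ext_level n N.
Let lvl (k : 'I_(n * N)) := (k %/ N).+1.

(** Multiplying the k-th scaled equation by z^2 / delta^(n+1) = -1 distributes
    the powers of delta over the factors z delta^(-b). *)
Lemma scaled_solution z x : 0 < complex.Im z -> x ord0 = 1 ->
  (forall k, k != ord0 -> residual n b (ext_entry S) (small n z) x k = 0) ->
  (forall k, 0 < complex.Im (size_at n z (lvl k) * x (lift ord0 k))) ->
  solves_at S z (fun k => size_at n z (lvl k) * x (lift ord0 k)).
Proof.
move=> z0 xo xres xIm; split=> // k; set P := size_at n z; set d := small n z in xres.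
have zn := uhp_neq0 z0.
have dn : d != 0.
  have := small_last n z0; rewrite -/d => e; apply/eqP => d0.
  by move: e; rewrite d0 expr0n /= => /esym/eqP; rewrite oppr_eq0 expf_eq0 /= (negbTE zn).
have PE j : P j = z / d ^+ j by rewrite -{1}(size_at_small n j z0) mulfK // expf_neq0.
have nk : lift ord0 k != ord0 by rewrite eq_sym neq_lift.
have := xres _ nk; rewrite /residual => /eqP; rewrite subr_eq0 => /eqP.
rewrite big_ord_recl xo mulr1 {1}/scaled ext_entry_root rmorph1 (mul1r (d ^+ _)) => xk.
have bk : b (lift ord0 k) = lvl k by exact: ext_level_lift.
rewrite /b ext_level0 addn0 -/b bk in xk.
have key : P (lvl k) * x (lift ord0 k) *
   (z + \sum_l (S k l)%:C * (P (lvl l) * x (lift ord0 l))) = -1.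
  transitivity (z ^+ 2 / d ^+ n.+1 * (x (lift ord0 k) *
     (d ^+ (n.+1 - lvl k) + \sum_(i < n * N)
        scaled n b (ext_entry S) d (lift ord0 k) (lift ord0 i) * x (lift ord0
          i)))); last first.
    by rewrite xk mulr1 /d small_last // invrN mulrN divff // expf_neq0.
  have lk : (lvl k <= n.+1)%N by have := level_le st (lift ord0 k);
    rewrite -/b bk => /leqW.
  have dX q : d ^+ q != 0 by rewrite expf_neq0.
  have split1 : d ^+ n.+1 = d ^+ (n.+1 - lvl k) * d ^+ lvl k by rewrite -exprD subnK.
  rewrite PE !mulrDr; congr (_ + _).
    by rewrite split1; field; rewrite !dX.
  rewrite !mulr_sumr; apply: eq_bigr => l _.
  rewrite /scaled ext_entry_lift bk (ext_level_lift l : b _ = _) -/(lvl l) PE.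
  have [big|le] := ltnP n.+1 (lvl k + lvl l).
    have := stair_zero st (_ : n.+1 < b (lift ord0 k) + b (lift ord0 l))%N.
    rewrite ext_entry_lift => ->; first by rewrite !mul0r !mulr0.
    by rewrite bk (ext_level_lift l : b _ = _).
  have -> : d ^+ n.+1 = d ^+ (n.+1 - (lvl k + lvl l)) * d ^+ lvl k * d ^+ lvl l.
    by rewrite -!exprD; congr (_ ^+ _); lia.
  by field; rewrite !dX.
have := xIm k; set w := size_at _ _ _ * _ => /uhp_neq0 wn.
by apply: (mulfI wn); rewrite [RHS]key mulrN mul1r divff.
Qed.
End Asymptotics.

(** * Asymptotics of the solution at the origin *)

Lemma sin_ge_endpoint (R : realType) (t u : R) :
  0 < t -> t <= u <= pi - t -> sin t <= sin u.
Proof.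
move=> t0 /andP[tu ut]; have p0 := pi_gt0 R.
have sinE (v : R) : sin v = cos (v - pi / 2).
  by rewrite cosB cos_pihalf sin_pihalf mulr0 add0r mulr1.
have cosN' (v : R) : cos v = cos `|v| by case: (ger0P v) => // _; rewrite cosN.
have h : `|u - pi / 2| <= pi / 2 - t by rewrite ler_norml; apply/andP; split; lra.
have ht : `|t - pi / 2| = pi / 2 - t by rewrite distrC ger0_norm //; lra.
rewrite !sinE cosN' [leRHS]cosN' ht.
have h1 : pi / 2 - t \in `[0, pi] by rewrite in_itv /=; apply/andP; split; lra.
have h2 : `|u - pi / 2| \in `[0, pi] by rewrite in_itv /= normr_ge0 /=; lra.
by rewrite leNgt ltr_cos // -leNgt.
Qed.

(** The argument of z delta^(-j) is a convex combination of j pi/(n+1) and pi -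
    j pi/(n+1), so it lies between pi/(n+1) and pi - pi/(n+1) whatever the
    direction of z. *)
Lemma size_at_uhp (R : realType) (n j : nat) (z xi : R[i]) (x0 rho : R) :
  0 < complex.Im z -> (0 < j <= n)%N -> 0 < x0 -> rho < sin (pi / n.+1%:R) ->
  normc (xi - x0%:C) <= rho * x0 -> 0 < complex.Im (size_at n z j * xi).
Proof.
move=> z0 /andP[j0 jn] x00 rho_lt close_xi; have p0 := pi_gt0 R.
have zn : 0 < normc z by rewrite normc_gt0 uhp_neq0.
have /andP[t0 tpi] := carg_bounds z0.
rewrite /size_at /cpow -/(cis _) -2!mulrA [cis _ * _]mulrA -cisD.
set a := 1 - _; set phi := _ + _.
have Im_mulC (r : R) (w : R[i]) : complex.Im (r%:C * w) = r * complex.Im w.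
  by case: w => x y /=; rewrite mul0r addr0.
rewrite Im_mulC mulr_gt0 ?powR_gt0 // -(subrK x0%:C xi) addrC mulrDr.
set E := cis phi * (_ - _).
have hE : normc E <= rho * x0 by rewrite normcM normc_cis mul1r.
have -> : complex.Im (cis phi * x0%:C + E) = sin phi * x0 + complex.Im E.
  by case: (E) => u v; rewrite /cis /=; simpc.
have : sin (pi / n.+1%:R) <= sin phi.
  have q0 : 0 < n.+1%:R :> R by rewrite ltr0n.
  apply: sin_ge_endpoint; first by rewrite divr_gt0.
  pose s : R := j%:R / n.+1%:R.
  have s1 : 1 / n.+1%:R <= s by rewrite ler_pM2r ?invr_gt0 // ler1n.
  have s2 : s <= 1 - 1 / n.+1%:R.
    rewrite ler_pdivrMr // mulrBl divfK ?gt_eqF // mul1r -natr1 addrK ler_nat //.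
  rewrite (_ : phi = (1 - 2 * s) * carg z + s * pi); last by rewrite /phi /a /s; ring.
  rewrite -[pi / n.+1%:R]mul1r mulrA (mulrAC 1).
  move: (1 / n.+1%:R) s1 s2 => e s1 s2.
  have e1 : e * pi <= s * pi by rewrite ler_pM2r.
  have e2 : e * pi <= (1 - s) * pi by rewrite ler_pM2r //; lra.
  have [h|h] := lerP 0 (1 - 2 * s).
    have : 0 <= (1 - 2 * s) * carg z by rewrite mulr_ge0 // ltW.
    have : (1 - 2 * s) * carg z <= (1 - 2 * s) * pi by rewrite ler_wpM2l // ltW.
    by move=> ? ?; apply/andP; split; lra.
  have : 0 <= (2 * s - 1) * carg z by rewrite mulr_ge0 // ?ltW //; lra.
  have : (2 * s - 1) * carg z <= (2 * s - 1) * pi by apply: ler_wpM2l; lra.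
  by move=> ? ?; apply/andP; split; lra.
move/(ler_wpM2r (ltW x00)) => h1.
have := normc_Im E; rewrite ler_norml => /andP[h2 _].
have : rho * x0 < sin (pi / n.+1%:R) * x0 by rewrite ltr_pM2r.
lra.
Qed.

Lemma nbhs0_disc (R : realType) (r : R) : 0 < r -> nbhs0 [set z : R[i] | normc z < r].
Proof.
move=> r0; have rC : 0 < (r%:C : R[i]^o) by rewrite ltcR.
apply: filterS (nbhsx_ballx (0 : R[i]^o) _ rC) => z.
by rewrite -ball_normE /= sub0r normrN normc_def ltcR => h; case: z h.
Qed.

Section Conclusion.
Variables (R : realType) (n N : nat) (S : 'M[R]_(n * N)) (m : R[i] -> 'I_(n * N) -> R[i]).
Hypotheses (N_gt0 : (0 < N)%N) (n_gt0 : (0 < n)%N).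
Hypothesis S_ge0 : forall k l, 0 <= S k l.
Hypothesis st : staircase n (@ext_level n N) (ext_entry S).
Hypothesis m_sol : is_solution S m.

Variables (x0 : 'I_(n * N).+1 -> R) (a : R).
Hypothesis x0_gt0 : forall k, 0 < x0 k.
Hypothesis x0_root : x0 ord0 = 1.
Hypothesis x0_lead : forall k, k != ord0 ->
  x0 k * (\sum_(l | (ext_level k + ext_level l == n.+1)%N) ext_entry S k l * x0 l) = 1.
Hypothesis flux_const : forall j, (j <= n)%N ->
  \sum_(k | @ext_level n N k == j) flux n (@ext_level n N) (ext_entry S) x0 k = a.

Lemma level_range (k : 'I_(n * N)) : (0 < (k %/ N).+1 <= n)%N.
Proof. exact: block_of. Qed.

(** The solution constructed from [local_solution] lies in the upper half-plane,
    so uniqueness identifies it with m z. *)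
Lemma solution_asymptotics (rho : R) : 0 < rho ->
  exists2 r : R, 0 < r & forall z, 0 < complex.Im z -> normc z < r ->
    forall k, exists2 xi, m z k = size_at n z (k %/ N).+1 * xi &
      normc (xi - (x0 (lift ord0 k))%:C) <= rho * x0 (lift ord0 k).
Proof.
move=> rho0; have p0 := pi_gt0 R.
have k0I : 0 < cos (pi / 3 : R) <= 1 by rewrite cos_third_gt0 cos_le1.
have s0 : 0 < sin (pi / n.+1%:R : R).
  apply: sin_gt0_pi; rewrite divr_gt0 //= ?ltr0n // ltr_pdivrMr ?ltr0n //.
  by rewrite ltr_pMr // ltr1n.
(* the second bound keeps the solution in the upper half-plane *)
pose rho' := Num.min rho (sin (pi / n.+1%:R) / 2).
have rho'0 : 0 < rho' by rewrite lt_min rho0 divr_gt0.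
have rho's : rho' < sin (pi / n.+1%:R).
  by apply: le_lt_trans (_ : sin (pi / n.+1%:R) / 2 < _); [rewrite ge_min lexx orbT|lra].
have [r r0 Hr] := local_solution st x0_gt0 x0_root x0_lead flux_const k0I rho'0.
exists (r `^ (n.+1%:R / 2)); first exact: powR_gt0.
move=> z z0 zr k.
have [x [xo xres xc]] := Hr _ (small_lt z0 r0 zr) (small_sector z0).
have sol := scaled_solution st z0 xo xres
  (fun k => size_at_uhp z0 (level_range k) (x0_gt0 _) rho's (xc _)).
have msol : solves_at S z (m z) by exact: m_sol.
exists (x (lift ord0 k)); first exact: (solves_at_unique S_ge0 z0 msol sol k).
by apply: le_trans (xc _) _; rewrite ler_pM2r // ge_min lexx.
Qed.

Lemma expoE (k : 'I_(n * N)) : expo R k = 1 - 2 / n.+1%:R * (k %/ N).+1%:R.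
Proof. by rewrite /expo ceilidxE. Qed.

Lemma solution_size (q : R) : 0 < q ->
  (forall k, k != ord0 -> x0 k <= q /\ 1 <= q * x0 k) ->
  exists U : set R[i], is_uhp_nbhd0 U /\ forall (k : 'I_(n * N)) (z : R[i]), U z ->
    (2 * q)^-1 < normc (m z k) * normc z `^ (- expo R k) < 2 * q.
Proof.
move=> q0 x0q.
have [|r r0 Hr] := @solution_asymptotics (1 / 4); first by lra.
exists ([set z | normc z < r] `&` @uhp R); split.
  by exists [set z | normc z < r] => //; exact: nbhs0_disc.
move=> k z [/= zr z0]; have [xi -> hxi] := Hr z z0 zr k.
have zn : normc z != 0 by rewrite normc_eq0 uhp_neq0.
rewrite normcM normcM normc_cpow // normc_cis mulr1 mulrAC -expoE -powRD; last first.
  by rewrite zn implybT.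
rewrite subrr powRr0 mul1r.
have nk : lift ord0 k != ord0 by rewrite eq_sym neq_lift.
have [h1 h2] := x0q _ nk; have xp := x0_gt0 (lift ord0 k).
move: (x0 _) h1 h2 xp hxi => y h1 h2 y0 hxi.
have u1 : normc xi <= normc (xi - y%:C) + y.
  by rewrite -{1}(subrK y%:C xi) -[X in _ <= _ + X]gtr0_norm // -normcC le_normcD.
have u2 : y <= normc (xi - y%:C) + normc xi.
  rewrite -normcN -{1}[y]gtr0_norm // -normcC.
  by rewrite -{1}(subrK xi y%:C) opprB le_normcD.
apply/andP; split; last lra.
rewrite -[ltLHS]mul1r ltr_pdivrMr ?mulr_gt0 //.
have : q * (3 / 4 * y) <= q * normc xi by rewrite ler_pM2l //; lra.
lra.
Qed.

Lemma solution_argument (k : 'I_(n * N)) :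
  carg (m z k * cpow z (- expo R k)) @[z --> within (@uhp R) (@nbhs0 R)] -->
  pi / n.+1%:R * ceilidx R k.
Proof.
rewrite ceilidxE // expoE.
have FF : Filter (within (@uhp R) (@nbhs0 R)) by apply: within_filter; exact: nbhs_filter.
apply/cvgrPdist_lt => e e0.
have [rho rho0 Hrho] := carg_near (size_at_angle R (level_range k)) e0.
have [r r0 Hr] := solution_asymptotics rho0.
rewrite /within /prop_near1 /=.
apply: filterS (nbhs0_disc r0) => z /= zr z0.
have [xi -> hxi] := Hr z z0 zr k.
rewrite (_ : _ * cpow _ _ = cis (pi / n.+1%:R * (k %/ N).+1%:R) * xi).
  by rewrite distrC; have [] := Hrho _ _ (x0_gt0 _) hxi.
rewrite /size_at -[cpow z _ * _ * _]mulrA mulrAC -cpowD // subrr cpow0 // mul1r //.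
Qed.

End Conclusion.

Theorem theorem1p5 (R : realType) (n : nat) (c C : R) :
  (1 <= n)%N -> 0 < c -> 0 < C ->
  exists C1 C2 : R, [/\ 0 < C1, 0 < C2 &
  forall (N : nat) (S : 'M[R]_(n * N)),
    (1 <= N)%N ->
    S^T = S ->
    (forall k l : 'I_(n * N), 0 <= S k l) ->
    (forall j k : 'I_n, posmx (block S j k) \/ block S j k = 0) ->
    (forall j k : 'I_n, posmx (block S j k) ->
      forall nu tau : 'I_N, c / N%:R < block S j k nu tau < C / N%:R) ->
    (forall j k : 'I_n, (n + 1 < j.+1 + k.+1)%N -> block S j k = 0) ->
    (forall j k : 'I_n,
      (j.+1 + k.+1 = n)%N \/ (j.+1 + k.+1 = n + 1)%N -> posmx (block S j k)) ->
    forall m : R[i] -> 'I_(n * N) -> R[i],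
    is_solution S m ->
    (exists U : set R[i], is_uhp_nbhd0 U /\
      forall (k : 'I_(n * N)) (z : R[i]), U z ->
        C1 < normc (m z k) * normc z `^ (- expo R k) < C2) /\
    (forall k : 'I_(n * N),
      carg (m z k * cpow z (- expo R k))
        @[z --> within (@uhp R) (@nbhs0 R)] -->
      pi / n.+1%:R * ceilidx R k)].
Proof.
move=> n0 c0 C0; set q := entry_ratio c C ^+ (4 * n).+1.
have q0 : 0 < q by rewrite exprn_gt0 // !addr_gt0 // invr_gt0.
exists (2 * q)^-1, (2 * q); split; [by rewrite invr_gt0 mulr_gt0|by rewrite mulr_gt0|].
move=> N S N0 S_sym S_ge0 _ S_bounds S_zero S_pos m m_sol.
have st := ext_staircase N0 n0 S_sym S_pos S_zero.
have card := @card_ext_level n N N0.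
have [x0 [a [x0_gt0 x0_root x0_lead x0_flux]]] := balanced_profile st N0 card.
have x0_bounds : forall k, k != ord0 -> x0 k <= q /\ 1 <= q * x0 k.
  apply: (profile_bounds st N0 card c0 C0 _ _ x0_gt0 x0_root x0_lead x0_flux).
    move=> k l; case: (unliftP ord0 k) => [i ->|->]; last by rewrite eqxx.
    case: (unliftP ord0 l) => [j ->|->]; last by rewrite eqxx.
    move=> _ _; rewrite !ext_level_lift ext_entry_lift (entry_block S N0) => e.
    exact/S_bounds/(block_pos N0 S_pos).
  move=> k; case: (unliftP ord0 k) => [i ->|->]; last by rewrite eqxx.
  by rewrite ext_entry_root.
split.
  exact: (solution_size N0 n0 S_ge0 st m_sol x0_gt0 x0_root x0_lead x0_flux q0 x0_bounds).
exact: (solution_argument N0 n0 S_ge0 st m_sol x0_gt0 x0_root x0_lead x0_flux).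
Qed.
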